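(* Let $n\geq 1$ be an integer and let $K_n$ denote the complete graph on $n$ vertices. Then $\theta(6,K_2)=1$, and for every $n\geq 1$ with $n\neq 2$ that is not of the form $n=3t+1$ with $t\geq 4$ an integer, we have \[\theta(6,K_n)=\left\lceil \frac{n+2}{3}\right\rceil .\]
   Context: All graphs are finite and simple. The girth of a graph is the length of its shortest cycle, or $\infty$ if the graph is acyclic. A graph is planar if it can be drawn in the plane without edge crossings. For an integer $g\geq 3$ and a graph $G$, the $g$-girth-thickness $\theta(g,G)$ is the minimum number of planar subgraphs of $G$, each of girth at least $g$, whose union is $G$. *)

(* Defs.v *)
(* MathComp-Analysis: the plane is R * R, with R an arbitrary realType. *)
From HB Require Import structures.
From mathcomp Require Import all_boot all_order all_algebra.
From mathcomp Require Import all_classical all_reals all_analysis.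

Set Implicit Arguments.
Unset Strict Implicit.
Unset Printing Implicit Defensive.

Import Order.TTheory GRing.Theory Num.Theory.
Import numFieldNormedType.Exports.

Local Open Scope ring_scope.

(* The least natural number satisfying P, or None if there is none. *)
Definition nat_min (P : nat -> Prop) : option nat :=
  match pselect (exists k, `[< P k >]) with
  | left exP => Some (ex_minn exP)
  | right _ => None
  end.

(* The vertex set is part of the data, so that the subgraphs of a graph on T
   are again graphs on T. *)
Record sgraph (T : finType) := SGraph {
  vset : {set T};
  eset : {set {set T}};
  esetP : [forall e in eset, (e \subset vset) && (#|e| == 2)]
}.

Definition adj (T : finType) (G : sgraph T) : rel T :=
  fun x y => [set x; y]%SET \in eset G.

Definition subgraph (T : finType) (H G : sgraph T) : bool :=
  (vset H \subset vset G) && (eset H \subset eset G).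

Definition is_union (T : finType) (k : nat) (H : 'I_k -> sgraph T)
    (G : sgraph T) : Prop :=
  vset G = (\bigcup_(i < k) vset (H i))%SET /\
  eset G = (\bigcup_(i < k) eset (H i))%SET.

Lemma complete_esetP (n : nat) :
  [forall e in [set e : {set 'I_n} | #|e| == 2]%SET,
     (e \subset [set: 'I_n]%SET) && (#|e| == 2)].
Proof. by apply/forall_inP => e; rewrite inE finset.subsetT. Qed.

Definition complete_graph (n : nat) : sgraph 'I_n := SGraph (complete_esetP n).

Definition has_cycle (T : finType) (G : sgraph T) (k : nat) : Prop :=
  exists c : seq T, [/\ size c = k, (3 <= k)%N & ucycle (adj G) c].

(* None stands for an infinite girth. *)
Definition girth (T : finType) (G : sgraph T) : option nat :=
  nat_min (has_cycle G).

Definition girth_geq (T : finType) (g : nat) (G : sgraph T) : bool :=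
  if girth G is Some k then (g <= k)%N else true.

(* A drawing places the vertices at distinct points of the plane and each edge
   e on the simple arc gamma e, parametrized by [0, 1], that joins the points
   of its two ends; away from its ends an arc meets no vertex and no other
   arc. *)
Definition is_drawing (R : realType) (T : finType) (G : sgraph T)
    (pos : T -> R * R) (gamma : {set T} -> R -> R * R) : Prop :=
  [/\ {in vset G &, injective pos},
      forall e, e \in eset G ->
        [/\ {within `[0, 1], continuous (gamma e)}%classic,
            {in `[0, 1] &, injective (gamma e)} &
            [set gamma e 0; gamma e 1]%classic
              = [set pos x | x in [set` e]]%classic],
      forall e x (t : R), e \in eset G -> x \in vset G -> t \in `]0, 1[ ->
        gamma e t <> pos x &
      forall e f (s t : R), e \in eset G -> f \in eset G -> e != f ->
        s \in `]0, 1[ -> t \in `]0, 1[ -> gamma e s <> gamma f t].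

Definition planar (R : realType) (T : finType) (G : sgraph T) : Prop :=
  exists (pos : T -> R * R) (gamma : {set T} -> R -> R * R),
    is_drawing G pos gamma.

Definition girth_cover (R : realType) (T : finType) (g : nat) (G : sgraph T)
    (k : nat) : Prop :=
  exists H : 'I_k -> sgraph T,
    (forall i, [/\ subgraph (H i) G, planar R (H i) & girth_geq g (H i)]) /\
    is_union H G.

(* The single vertices and single edges of G form such a cover, so the
   default value is never reached. As unions are taken on vertex sets too,
   the value is 0 only for the graph without vertices. *)
Definition girth_thickness (R : realType) (T : finType) (g : nat)
    (G : sgraph T) : nat :=
  odflt 0 (nat_min (girth_cover R g G)).

(* Main.v *)
(* Lower bound. Overlaying a drawing with a fine square grid exhibits the graph as
   a minor of the grid. Over F_2, a cycle of the grid is the coboundary of a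
   function on its faces, and merging the faces separated by a deleted grid edge
   gives the faces of the drawing. Comparing dimensions yields Euler's inequality,
   hence [g * (E + 2) <= 2 * E + g * V] for a planar graph of girth at least [g]
   that has more than [V - 1] edges, and the bound follows by counting edges.

   Upper bound. Planarity is obtained from two-page book embeddings. For [N = 2 * q + 1],
   the complete graph on three copies of the integers modulo [N] is the union of
   the [N] shifts of a ring of three bundles of paths of length 3, and of a cycle
   of length [3 * N]. For three more vertices x, y, z, the shifts have room for
   pendant edges at these vertices and for three more paths; the cycle is shared
   by two graphs that contain stars at x, y, z. These cover [3 * t] vertices with
   [t + 1] graphs for [t >= 5]; the complete graphs on 4, 7, 10 and 12 vertices
   have explicit covers, and all other cases follow by restriction. *)

(* A drawing consists of arbitrary continuous arcs, and no faces are extracted from it: all that is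
   used is a mesh fine enough to keep disjoint compact pieces apart. Arcs with a common end come
   arbitrarily close, so no mesh separates them there. Hence every edge is cut into thirds: the
   outer thirds go into the branch sets of their vertices, and the grid edge that represents the
   edge is found along the middle third.

   The upper bound leaves little room: a shift of the ring has [9 * q] edges on [6 * q + 3]
   vertices, where Euler's inequality permits at most [9 * q + 1]. Write A_i, B_i, C_i for the three
   copies. The chords A_(i+j) A_(i-j) have difference [2 * j], so the shifts of the chords with
   [0 < j < q], and of one more edge in each class, realize all differences inside a class. The
   other edges realize all differences but one between consecutive classes; the exceptions form the
   cycle A_0 B_0 C_0 A_1 B_1 C_1 and so on. *)
Require Import Defs.
From HB Require Import structures.
From mathcomp Require Import all_boot all_order all_algebra.
From mathcomp Require Import all_classical all_reals all_analysis.
From mathcomp Require Import zify ring lra.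

Set Implicit Arguments.
Unset Strict Implicit.
Unset Printing Implicit Defensive.

Import Order.TTheory GRing.Theory Num.Theory.
Import numFieldNormedType.Exports.

Local Open Scope ring_scope.

(** * Euler's inequality for minors of the square grid *)

Lemma F2_addxx (x : 'F_2) : x + x = 0.
Proof. by rewrite -mulr2n -mulr_natr (_ : 2%:R = 0) ?mulr0 //; apply/val_inj. Qed.

Lemma F2_cases (x : 'F_2) : x = 0 \/ x = 1.
Proof. by case: x => -[|[|//]] hi; [left|right]; apply/val_inj. Qed.

Lemma F2_addb (x y : bool) : (x (+) y)%:R = x%:R + y%:R :> 'F_2.
Proof. by case: x; case: y => //=; rewrite ?addr0 ?add0r ?F2_addxx. Qed.

Lemma F2_eq0_odd (n : nat) : (n%:R == 0 :> 'F_2) = ~~ odd n.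
Proof.
elim: n => [|n IHn]; first by rewrite eqxx.
rewrite mulrS /=.
by case: (F2_cases (1 *+ n)) IHn => -> /=; case: (odd n).
Qed.

Lemma F2_sum_bool (I : finType) (P : pred I) (b : I -> bool) :
  (\sum_(i | P i) (b i)%:R == 0 :> 'F_2) = ~~ odd #|[set i | P i & b i]|.
Proof.
rewrite -natr_sum F2_eq0_odd -big_mkcondr /= sum1dep_card.
by rewrite cardsE.
Qed.

(* The cycle space of the graph is contained in the cut space of the graph with
   vertex set [C] and edges [l e -- r e]; comparing dimensions bounds the number
   of faces [c : C] with non-zero boundary from below, while each of them takes
   up at least [g] of the [2 * #|I|] edge sides. *)
Lemma dual_edge_bound (T I C : finType) (ends : I -> {set T}) (l r : I -> C)
    (g : nat) :
  (forall e, #|ends e| = 2%N) ->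
  (forall z : I -> 'F_2, (forall v, \sum_(e | v \in ends e) z e = 0) ->
     exists f : C -> 'F_2, forall e, z e = f (l e) + f (r e)) ->
  (forall c v, \sum_(e | v \in ends e) ((l e == c) (+) (r e == c))%:R
     = 0 :> 'F_2) ->
  (forall B : {set I}, B != finset.set0 ->
     (forall v, ~~ odd #|[set e in B | v \in ends e]|) -> g <= #|B|)%N ->
  (#|I| <= #|T|.-1 \/ g * (#|I| + 2) <= 2 * #|I| + g * #|T|)%N.
Proof.
move=> ends2 dual bdry girth.
pose b c := [set e | (l e == c) (+) (r e == c)].
(* Only faces with a non-empty boundary are counted, as the girth bounds no other boundary from
   below. *)
pose K := [set c | b c != finset.set0].
pose m := #|I|; pose n := #|T|; pose q := #|K|.
have pick (f : C -> 'F_2) x : \sum_c f c * (x == c)%:R = f x.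
  rewrite (bigD1 x) //= eqxx mulr1 big1 ?addr0 // => c.
  by rewrite eq_sym => /negPf ->; rewrite mulr0.
pose B : 'M['F_2]_(m, n) := \matrix_(i, j) (enum_val j \in ends (enum_val i))%:R.
pose D : 'M['F_2]_(q, m) := \matrix_(i, j) (enum_val j \in b (enum_val i))%:R.
(* Every edge has two ends, so the incidence matrix kills the all-ones vector. *)
have rankB : (\rank B <= n.-1)%N.
  have [n0|n0] := posnP n; first by have := rank_leq_col B; lia.
  have B1 : B *m (const_mx 1 : 'cV_n) = 0.
    apply/matrixP => i j; rewrite !mxE.
    under eq_bigr do rewrite !mxE mulr1.
    rewrite (reindex _ (onW_bij _ (enum_rank_bij T))) /=.
    under eq_bigr do rewrite enum_rankK.
    apply/eqP; rewrite F2_sum_bool.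
    rewrite (_ : [set _ | _ & _] = ends (enum_val i)) ?ends2 //.
    by apply/setP => v; rewrite !inE.
  have := mulmx0_rank_max B1.
  suff : (0 < \rank (const_mx 1%R : 'cV['F_2]_n))%N by lia.
  rewrite lt0n mxrank_eq0; apply/eqP => /matrixP /(_ (Ordinal n0) ord0).
  by rewrite !mxE.
(* Every edge has two sides, so the boundaries of all faces add up to 0. *)
have rankD : (0 < q -> \rank D < q)%N.
  move=> q0.
  have D1 : (const_mx 1 : 'rV_q) *m D = 0.
    apply/matrixP => i j; rewrite !mxE.
    under eq_bigr do rewrite !mxE mul1r.
    rewrite -(big_enum_val (fun c => (enum_val j \in b c)%:R)) /=.
    rewrite [LHS](_ : _ = \sum_c (enum_val j \in b c)%:R); last first.
      rewrite [RHS](bigID (mem K)) /= [X in _ + X]big1 ?addr0 // => c.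
      rewrite inE negbK => /eqP ->; by rewrite inE.
    under eq_bigr do rewrite inE F2_addb.
    have pick1 (x : C) : \sum_c (x == c)%:R = 1 :> 'F_2.
      by rewrite -[RHS](pick (fun=> 1) x); apply: eq_bigr => c _; rewrite mul1r.
    by rewrite big_split /= !pick1 F2_addxx.
  have := mulmx0_rank_max D1.
  suff : (0 < \rank (const_mx 1%R : 'rV['F_2]_q))%N by lia.
  rewrite lt0n mxrank_eq0; apply/eqP => /matrixP /(_ ord0 (Ordinal q0)).
  by rewrite !mxE.
(* The cycle space is spanned by the face boundaries: [f] from [dual] gives the coefficients. *)
have kerD : (kermx B <= D)%MS.
  apply/row_subP => k; set u := row k _.
  have /sub_kermxP uB : (u <= kermx B)%MS by rewrite row_sub.
  have [v|f fE] := dual (fun e => u ord0 (enum_rank e)).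
    move/matrixP: uB => /(_ ord0 (enum_rank v)); rewrite !mxE => uB.
    rewrite -[RHS]uB [RHS](reindex _ (onW_bij _ (enum_rank_bij I))) /= big_mkcond.
    apply: eq_bigr => e _; rewrite !mxE !enum_rankK.
    by case: ifP; rewrite ?mulr1 ?mulr0.
  suff -> : u = (\row_i f (enum_val i)) *m D by rewrite submxMl.
  apply/rowP => j; rewrite -{1}(enum_valK j) fE !mxE.
  under eq_bigr do rewrite !mxE.
  rewrite -(big_enum_val (fun c => f c * (enum_val j \in b c)%:R)) /=.
  rewrite [RHS](_ : _ = \sum_c f c * (enum_val j \in b c)%:R); last first.
    rewrite [RHS](bigID (mem K)) /= [X in _ + X]big1 ?addr0 // => c.
    by rewrite inE negbK => /eqP ->; rewrite inE mulr0.
  under eq_bigr do rewrite inE F2_addb mulrDr.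
  by rewrite big_split /= !pick.
have facesE : (g * q <= 2 * m)%N.
  rewrite mulnC -sum_nat_const (leq_trans (n := \sum_(c in K) #|b c|)) //.
    apply: leq_sum => c; rewrite inE => bc0; apply: girth => // v.
    have /eqP := bdry c v; rewrite F2_sum_bool; congr (~~ odd _).
    by apply: eq_card => e; rewrite !inE andbC.
  rewrite mulnC -sum_nat_const.
  under eq_bigr do rewrite -sum1_card.
  rewrite (exchange_big_dep predT) //=; apply: leq_sum => e _.
  rewrite sum1dep_card.
  apply: leq_trans (_ : #|[set l e; r e]%SET| <= 2)%N; last first.
    by rewrite cards2; case: (_ == _).
  apply/subset_leq_card/fintype.subsetP => c; rewrite !inE => /andP[_].
  by rewrite !(eq_sym c); case: (_ == c); case: (_ == c).
have := mxrankS kerD; rewrite mxrank_ker leq_subLR => rBD.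
have {}rBD := leq_trans rBD (leq_add rankB (leqnn _)).
have [q0|q0] := posnP q.
  left; apply: leq_trans rBD _; rewrite -[leqRHS]addn0 leq_add2l.
  by rewrite (leq_trans (rank_leq_row D)) // q0.
have [n0|n0] := posnP n.
  left; suff : m = 0%N by rewrite /m => ->.
  apply/eqP; rewrite -leqn0 leqNgt; apply/negP => /card_gt0P[e _].
  have : (#|ends e| <= n)%N by exact: max_card.
  by rewrite ends2 n0.
right; have rD := rankD q0.
(* Euler's inequality, with [q] faces; it follows from [m - rank B <= rank D]. *)
have mq : (m + 2 <= n + q)%N.
  rewrite (leq_trans (leq_add rBD (leqnn 2))) // -[in leqRHS](prednK n0).
  by rewrite -addnA addn2 addSnnS leq_add2l.
by rewrite (leq_trans (leq_mul (leqnn g) mq)) // mulnDr addnC leq_add2r.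
Qed.

(** * Cycles in graphs with even degrees *)

Section EvenSubgraph.
Variables (T : finType) (B : {set {set T}}).
Hypothesis B2 : forall e, e \in B -> #|e| = 2%N.
Hypothesis B_even : forall v, ~~ odd #|[set e in B | v \in e]|.

Let a : rel T := fun x y => [set x; y]%SET \in B.

Let a_sym : symmetric a.
Proof. by move=> x y; rewrite /a finset.setUC. Qed.

Let a_irr x : a x x = false.
Proof. by apply/negP => /B2; rewrite finset.setUid cards1. Qed.

Lemma even_subgraph_other_neighbour x y : a x y -> exists2 z, z != y & a x z.
Proof.
move=> axy; pose S := [set e in B | x \in e].
have xyS : [set x; y]%SET \in S by rewrite inE [_ \in B]axy !inE eqxx.
have [/eqP S1|S1] := boolP (#|S| == 1%N).
  by have := B_even x; rewrite -/S S1.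
have : (0 < #|S :\ [set x; y]%SET|)%N.
  by move: S1; rewrite (cardsD1 [set x; y]%SET) xyS; case: #|_ :\ _|.
case/card_gt0P => e; rewrite !inE => /andP[exy /andP[eB xe]].
have /eqP := B2 eB; rewrite (cardsD1 x) xe eqSS => /cards1P[z zE].
have eE : e = [set x; z]%SET by rewrite -(finset.setD1K xe) zE.
by exists z; [apply: contraNneq exy => <-; rewrite eE|rewrite /a -eE].
Qed.

(** The path grows at its head [x]: by parity [x] has a neighbour [z] other than [y]. As the graph
    is finite, [z] eventually lies on the path and closes a cycle, of length at least 3 because [z]
    is not [y]. *)
Lemma even_subgraph_cycle_from x y p : path a x (y :: p) -> uniq (x :: y :: p) ->
  exists2 c, (2 < size c)%N & ucycle a c.
Proof.
have [n] := ubnP (#|T| - size p); elim: n => // n IHn in x y p * => ltpn xp Ux.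
have axy : a x y by case/andP: xp.
have [z zy axz] := even_subgraph_other_neighbour axy.
have [zp|zp] := boolP (z \in y :: p); last first.
  apply: (IHn z x (y :: p)); last 2 first.
  - by rewrite /= a_sym axz.
  - rewrite cons_uniq Ux andbT inE negb_or zp andbT.
    by apply: contraTneq axz => ->; rewrite a_irr.
  have := uniq_leq_size Ux (fun v _ => mem_enum T v : v \in enum T).
  by rewrite -cardE /=; move: ltpn => /=; lia.
rewrite inE (negPf zy) /= in zp.
case/splitPr: zp xp Ux => p1 p2.
rewrite -cat_rcons -!cat_cons cat_path cat_uniq.
move=> /andP[xp1 _] /andP[Ux _].
exists (x :: y :: rcons p1 z); first by rewrite /= size_rcons.
by rewrite /ucycle Ux andbT /cycle rcons_path xp1 /= last_rcons a_sym axz.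
Qed.

Lemma even_subgraph_cycle : B != finset.set0 ->
  exists c, [/\ (2 < size c)%N, (size c <= #|B|)%N & ucycle a c].
Proof.
case/finset.set0Pn => e eB; have /eqP/cards2P[x [y [xy eE]]] := B2 eB.
have axy : a x y by rewrite /a -eE.
have [||c c3 Uc] := @even_subgraph_cycle_from x y [::].
- by rewrite /= axy.
- by rewrite /= inE xy.
exists c; split=> //.
have /andP[cyc_c uniq_c] := Uc.
(* Double counting: the right side is the sum of all degrees, and each vertex of the cycle has
   positive even degree, hence degree at least 2. *)
suff : (\sum_(v in c) 2 <= \sum_(e in B) 2)%N.
  by rewrite !sum_nat_const (card_uniqP uniq_c) leq_mul2r.
rewrite [leqRHS](eq_bigr (fun e : {set T} => \sum_(v in e) 1)%N); last first.
  by move=> f fB; rewrite sum1_card B2.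
rewrite (exchange_big_dep predT) //= [leqRHS](bigID (mem c)) /= -[leqLHS]addn0.
rewrite leq_add //; apply: leq_sum => v vc.
rewrite sum1dep_card; have := B_even v; set d := #|_|.
suff : (0 < d)%N by case: d => [|[|]].
apply/card_gt0P; exists [set v; next c v]%SET.
by rewrite !inE eqxx andbT; exact: (next_cycle cyc_c vc).
Qed.
End EvenSubgraph.

(* The edge [(true, p)] of the square grid on [nat * nat] goes up from [p], and
   [(false, p)] goes right. The unit square with upper right corner [p] is
   called the face [p]; faces [(0, _)] and [(_, 0)] are unbounded. *)
Definition grid_end (d : bool * (nat * nat)) : nat * nat :=
  if d.1 then (d.2.1, d.2.2.+1) else (d.2.1.+1, d.2.2).
Definition face1 (d : bool * (nat * nat)) : nat * nat := (d.2.1.+1, d.2.2.+1).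
(** The square to the left of an upward edge, or below a rightward edge, has the far end of the edge
    as its upper right corner; hence the formula of [grid_end]. *)
Definition face2 (d : bool * (nat * nat)) : nat * nat :=
  if d.1 then (d.2.1, d.2.2.+1) else (d.2.1.+1, d.2.2).

Definition grid_adj (p q : nat * nat) : bool :=
  [exists d : bool, (q == grid_end (d, p)) || (p == grid_end (d, q))].

(** The boundary modulo 2 of the 1-chain [h]. On the axes, the missing edges to the left and below
    count as 0. *)
Definition grid_bd (h : bool * (nat * nat) -> 'F_2) (p : nat * nat) : 'F_2 :=
  h (false, p) + h (true, p)
  + (if p.1 is i.+1 then h (false, (i, p.2)) else 0)
  + (if p.2 is j.+1 then h (true, (p.1, j)) else 0).

Lemma grid_bdD h1 h2 p :
  grid_bd (fun d => h1 d + h2 d) p = grid_bd h1 p + grid_bd h2 p.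
Proof.
by case: p => [[|i] [|j]]; rewrite /grid_bd /= ?addr0; ring.
Qed.

Lemma grid_bdZ c h p : grid_bd (fun d => c * h d) p = c * grid_bd h p.
Proof. by case: p => [[|i] [|j]]; rewrite /grid_bd /= ?addr0; ring. Qed.

Lemma grid_bd0 p : grid_bd (fun=> 0) p = 0.
Proof. by case: p => [[|i] [|j]]; rewrite /grid_bd /= !addr0. Qed.

Lemma grid_bd_sum (I : finType) (h : I -> bool * (nat * nat) -> 'F_2) p :
  grid_bd (fun d => \sum_i h i d) p = \sum_i grid_bd (h i) p.
Proof.
by case: p => [[|i] [|j]]; rewrite /grid_bd /= ?addr0 -!big_split /=;
  apply: eq_bigr => k _; rewrite ?addr0.
Qed.

Lemma grid_bd_delta d p :
  grid_bd (fun d' => (d' == d)%:R) p = (p == d.2)%:R + (p == grid_end d)%:R.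
Proof.
case: d p => -[] [i j] [[|i'] [|j']];
  rewrite /grid_bd /grid_end /= !xpair_eqE /= ?eqSS ?addr0 ?add0r ?andbF //=;
  rewrite ?addr0 //.
Qed.

(** Discrete Poincare lemma: [f] counts modulo 2 the edges of [h] that a horizontal ray crosses from
    the left border to the face. This settles vertical edges; for horizontal ones, induction along
    the row uses that [h] is closed at each corner. *)
Lemma grid_primitive (h : bool * (nat * nat) -> 'F_2) :
  (forall d, d.2.1 = 0%N \/ d.2.2 = 0%N -> h d = 0) ->
  (forall p, grid_bd h p = 0) ->
  exists f, forall d, h d = f (face1 d) + f (face2 d).
Proof.
move=> h0 hbd.
pose f p := if p.2 is j.+1 then \sum_(k < p.1) h (true, (val k, j)) else 0.
exists f => -[[] [i j]]; rewrite /face1 /face2 /f /=.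
  by rewrite big_ord_recr /= addrAC F2_addxx add0r.
case: j => [|j].
  by rewrite big1 ?h0 ?addr0 //=; [right|move=> k _; rewrite h0 //; right].
elim: i => [|i IHi].
  by rewrite !big_ord_recr !big_ord0 /= !h0 ?addr0 //; left.
rewrite [X in _ = X + _]big_ord_recr [X in _ = _ + X]big_ord_recr /=.
have := hbd (i.+1, j.+1); rewrite /grid_bd /= IHi => bd0.
rewrite -[LHS]addr0 -[in LHS]bd0; set x := h _; set y := h _; set z := h _.
set S1 := \sum_(_ < _) _; set S2 := \sum_(_ < _) _.
transitivity ((x + x) + (y + z + S1 + S2)); first by ring.
by rewrite F2_addxx; ring.
Qed.

(** [h] is the sum of the edges of the walk, in which the inner vertices cancel modulo 2. *)
Lemma grid_path_chain (W : pred (nat * nat)) p s :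
  path (fun q q' => [&& grid_adj q q', W q & W q']) p s ->
  exists h : bool * (nat * nat) -> 'F_2,
    (forall q, grid_bd h q = (q == p)%:R + (q == last p s)%:R) /\
    (forall d, h d != 0 -> W d.2 && W (grid_end d)).
Proof.
elim: s p => [|q s IHs] p /=.
  exists (fun=> 0); split=> [q|d]; last by rewrite eqxx.
  by rewrite grid_bd0 F2_addxx.
move=> /andP[/and3P[/existsP[b pq] Wp Wq] {}/IHs [h [hbd hW]]].
have [d [dW dE]] : exists d, W d.2 && W (grid_end d) /\
    forall q', grid_bd (fun d' => (d' == d)%:R) q' = (q' == p)%:R + (q' == q)%:R.
  case/orP: pq => /eqP E; [exists (b, p)|exists (b, q)];
  by rewrite /= -E Wp Wq; split=> // q'; rewrite grid_bd_delta /= -E // addrC.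
exists (fun d' => (d' == d)%:R + h d'); split=> [q'|d'].
  rewrite grid_bdD hbd dE -addrA; congr (_ + _).
  by rewrite addrA F2_addxx add0r.
by have [->//|_] := eqVneq d' d; rewrite add0r => /hW.
Qed.

Lemma sum_nat_shift (N : nat) (F : nat -> 'F_2) : F 0%N = 0 -> F N = 0 ->
  \sum_(i < N) F i = \sum_(i < N) F i.+1.
Proof.
move=> F0 FN; transitivity (\sum_(i < N.+1) F i).
  by rewrite big_ord_recr /= FN addr0.
by rewrite big_ord_recl /= F0 add0r.
Qed.

(** Cycles are orthogonal to cuts. After summation by parts, each face value [X i j] is multiplied
    by the coboundary of [w] summed over the four sides of the face, where every corner occurs
    twice. *)
Lemma grid_coboundary_orthogonal (N : nat) (x w : nat * nat -> 'F_2) :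
  (forall p, p.1 = 0%N \/ p.2 = 0%N \/ p.1 = N \/ p.2 = N -> w p = 0) ->
  \sum_(b : bool) \sum_(i < N) \sum_(j < N)
    (fun d => (x (face1 d) + x (face2 d)) * (w d.2 + w (grid_end d)))
      (b, (val i, val j)) = 0.
Proof.
move=> w0; rewrite big_bool /= /face1 /face2 /grid_end /=.
pose X (i j : nat) := x (i.+1, j.+1).
under eq_bigr do under eq_bigr do rewrite mulrDl.
under [X in _ + X]eq_bigr do under eq_bigr do rewrite mulrDl.
under eq_bigr do rewrite big_split /=.
under [X in _ + X]eq_bigr do rewrite big_split /=.
rewrite !big_split /=.
have -> : \sum_(i < N) \sum_(j < N) x (val i, j.+1) * (w (val i, val j) + w (val i, j.+1))
  = \sum_(i < N) \sum_(j < N) X i j * (w (i.+1, val j) + w (i.+1, j.+1)).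
  rewrite (@sum_nat_shift N (fun i => \sum_(j < N) x (i, j.+1) * (w (i, val j) + w (i, j.+1)))) //;
    by rewrite big1 // => j _; rewrite !w0 ?addr0 ?mulr0 //=; tauto.
have -> : \sum_(i < N) \sum_(j < N) x (i.+1, val j) * (w (val i, val j) + w (i.+1, val j))
  = \sum_(i < N) \sum_(j < N) X i j * (w (val i, j.+1) + w (i.+1, j.+1)).
  apply: eq_bigr => i _.
  rewrite (@sum_nat_shift N (fun j => x (i.+1, j) * (w (val i, j) + w (i.+1, j)))) //;
    by rewrite !w0 ?addr0 ?mulr0 //=; tauto.
rewrite -!big_split big1 //= => i _; rewrite -!big_split big1 //= => j _.
rewrite -/(X i j).
set w1 := w _; set w2 := w _; set w3 := w _; set w4 := w _.
transitivity (X i j * ((w1 + w1) + (w2 + w2) + (w3 + w3) + (w4 + w4))).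
  by ring.
by rewrite !F2_addxx mulr0.
Qed.

(** * Euler's inequality for a grid minor with branch sets [W v] *)

Section GridMinor.
Variables (T I : finType) (ends : I -> {set T}) (N : nat).
Variables (W : T -> pred (nat * nat)) (c : T -> nat * nat).
Variable a : I -> bool * (nat * nat).
Hypothesis ends_inj : injective ends.
Hypothesis W_bound : forall v p, W v p ->
  [&& 0 < p.1, p.1 < N, 0 < p.2 & p.2 < N]%N.
Hypothesis W_disj : forall u v p, W u p -> W v p -> u = v.
Hypothesis W_conn : forall v p, W v p -> exists s,
  path (fun q q' => [&& grid_adj q q', W v q & W v q']) (c v) s
  /\ last (c v) s = p.
Hypothesis aP : forall e, exists u v, [/\ u != v, ends e = [set u; v]%SET,
  W u (a e).2 & W v (grid_end (a e))].

Let a_inj : injective a.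
Proof.
move=> e f aef; apply: ends_inj.
have [u [v [_ -> Wu Wv]]] := aP e; have [u' [v' [_ -> Wu' Wv']]] := aP f.
rewrite aef in Wu Wv.
by rewrite (W_disj Wu Wu') (W_disj Wv Wv').
Qed.

(* The grid edges that survive in the minor: those contracted, and those kept. *)
Let S (d : bool * (nat * nat)) : bool :=
  [exists v, W v d.2 && W v (grid_end d)] || [exists e, a e == d].

Let not_internal e v : W v (a e).2 -> W v (grid_end (a e)) -> False.
Proof.
have [u [u' [uu' _ Wu Wu']]] := aP e => Wv Wv'.
by case/eqP: uu'; rewrite (W_disj Wu Wv) (W_disj Wu' Wv').
Qed.

(** Each edge [e] is replaced by [a e] together with walks inside the branch sets from its ends to
    the centres [c v]. A cycle of the graph thus becomes a closed 1-chain of the grid supported on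
    surviving edges, and [f] is its primitive. *)
Let lift_cycle (z : I -> 'F_2) :
  (forall v, \sum_(e | v \in ends e) z e = 0) ->
  exists f, (forall e, z e = f (face1 (a e)) + f (face2 (a e))) /\
    (forall d, ~~ S d -> f (face1 d) = f (face2 d)).
Proof.
move=> z0.
have spoke e : exists h : bool * (nat * nat) -> 'F_2,
   (forall q, grid_bd h q = \sum_(v in ends e) (q == c v)%:R) /\
   (forall d, h d != (d == a e)%:R -> exists v, W v d.2 && W v (grid_end d)).
  have [u [v [uv -> Wu Wv]]] := aP e.
  have [su [/grid_path_chain [hu [hu_bd huW]] lu]] := W_conn Wu.
  have [sv [/grid_path_chain [hv [hv_bd hvW]] lv]] := W_conn Wv.
  exists (fun d => (d == a e)%:R + (hu d + hv d)); split=> [q|d].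
    rewrite !grid_bdD hu_bd hv_bd lu lv grid_bd_delta.
    rewrite big_setU1 ?inE //= big_set1.
    set x1 := (q == (a e).2)%:R; set x2 := (q == grid_end _)%:R.
    transitivity ((x1 + x1) + (x2 + x2) + ((q == c u)%:R + (q == c v)%:R)).
      by ring.
    by rewrite !F2_addxx !add0r.
  rewrite -subr_eq0 addrC addKr => huv.
  have [hu0|/huW hu0] := eqVneq (hu d) 0; last by exists u.
  by exists v; apply: hvW; rewrite hu0 add0r in huv.
have [h hP] := choice spoke.
pose H d := \sum_e z e * h e d.
have H_bd q : grid_bd H q = 0.
  rewrite grid_bd_sum; under eq_bigr do rewrite grid_bdZ (hP _).1 mulr_sumr.
  rewrite (exchange_big_dep predT) //= big1 // => v _.
  by rewrite -mulr_suml z0 mul0r.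
have H_supp d : H d != 0 -> S d.
  apply: contraNT; rewrite negb_or => /andP[/existsPn W0 /existsPn a0].
  rewrite /H big1 // => e _.
  have [->|/(hP e).2 [v]] := eqVneq (h e d) (d == a e)%:R.
    by rewrite eq_sym (negPf (a0 e)) mulr0.
  by rewrite (negPf (W0 v)).
have [d|f fP] := grid_primitive _ H_bd.
  move=> d0; apply: contraTeq (isT) => /H_supp; rewrite /S.
  suff W0 v : W v d.2 -> False.
    case/orP=> /existsP[v]; first by case/andP => /W0.
    move/eqP => av; have [u [_ [_ _ Wu _]]] := aP v.
    by rewrite av in Wu; case: (W0 _ Wu).
  by move/W_bound; case: d0 => ->; rewrite ?andbF.
exists f; split=> [e|d Sd].
  rewrite -fP /H (bigD1 e) //= big1 => [|e' e'e].
    have [->|/(hP e).2 [v]] := eqVneq (h e (a e)) (a e == a e)%:R.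
      by rewrite eqxx mulr1 addr0.
    by case/andP=> /not_internal H1 /H1.
  have [->|/(hP e').2 [v]] := eqVneq (h e' (a e)) (a e == a e')%:R.
    by rewrite (inj_eq a_inj) eq_sym (negPf e'e) mulr0.
  by case/andP=> /not_internal H1 /H1.
have := fP d; have [->|/H_supp] := eqVneq (H d) 0; last by rewrite (negPf Sd).
by move/(congr1 (+%R^~ (f (face2 d)))); rewrite add0r -addrA F2_addxx addr0.
Qed.

Let cell (p : nat * nat) : 'I_N.+1 * 'I_N.+1 := (inord p.1, inord p.2).

Let cellK p : (p.1 <= N)%N -> (p.2 <= N)%N -> (val (cell p).1, val (cell p).2) = p.
Proof. by case: p => i j /= iN jN; rewrite !inordK. Qed.

(* Faces that the deletion of the other grid edges merges. *)
Let merged (x y : 'I_N.+1 * 'I_N.+1) : bool :=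
  [exists d : bool * ('I_N * 'I_N), let d' := (d.1, (val d.2.1, val d.2.2)) in
    ~~ S d' && (((x, y) == (cell (face1 d'), cell (face2 d')))
             || ((x, y) == (cell (face2 d'), cell (face1 d'))))].

Let merged_sym : connect_sym merged.
Proof.
apply: sym_connect_sym => x y; apply: eq_existsb => d /=.
by rewrite orbC !xpair_eqE [X in _ && (X || _)]andbC [X in _ && (_ || X)]andbC.
Qed.

Let merged_invariant (A : eqType) (f : nat * nat -> A) :
  (forall d, ~~ S d -> f (face1 d) = f (face2 d)) ->
  forall x y, connect merged x y ->
  f (val x.1, val x.2) = f (val y.1, val y.2).
Proof.
move=> fS x y /connectP[s + ->]; elim: s x => //= z s IHs x /andP[xz /IHs <-].
have face_cell (d : bool * ('I_N * 'I_N)) : let d' := (d.1, (val d.2.1, val d.2.2)) in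
    ((face1 d').1 <= N)%N && ((face1 d').2 <= N)%N
    && (((face2 d').1 <= N)%N && ((face2 d').2 <= N)%N).
  case: d => -[] [i j] /=; rewrite /face1 /face2 /= ?ltn_ord ?(ltnW (ltn_ord _)) //.
case/existsP: xz => d; have := face_cell d.
set d' := (d.1, _) => /= /andP[/andP[f11 f12] /andP[f21 f22]] /andP[/fS fd].
by case/orP => /eqP [-> ->]; rewrite !cellK.
Qed.

Let a_range e : [&& 0 < (a e).2.1, (a e).2.1 < N, 0 < (a e).2.2 & (a e).2.2 < N]%N.
Proof. by have [u [v [_ _ /W_bound]]] := aP e. Qed.

Let a_lt1 e : ((a e).2.1 < N)%N.
Proof. by have /and4P[] := a_range e. Qed.

Let a_lt2 e : ((a e).2.2 < N)%N.
Proof. by have /and4P[] := a_range e. Qed.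

(** Orthogonality of the boundary of the merged face [k] and the cut around [W v]. Contracted edges
    contribute 0 as [w] agrees at their ends, deleted edges as [x] agrees on their sides; what is
    left are the edges [a e]. *)
Let boundary_even (k : 'I_N.+1 * 'I_N.+1) v :
  \sum_(e | v \in ends e) ((fingraph.root merged (cell (face1 (a e))) == k)
                       (+) (fingraph.root merged (cell (face2 (a e))) == k))%:R = 0 :> 'F_2.
Proof.
pose x (p : nat * nat) : 'F_2 := (fingraph.root merged (cell p) == k)%:R.
pose w (p : nat * nat) : 'F_2 := (W v p)%:R.
pose K d := (x (face1 d) + x (face2 d)) * (w d.2 + w (grid_end d)).
have w0 p : p.1 = 0%N \/ p.2 = 0%N \/ p.1 = N \/ p.2 = N -> w p = 0.
  rewrite /w; case: (boolP (W v p)) => // /W_bound /and4P[].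
  by move=> p1 p1N p2 p2N p0; exfalso; lia.
have K0 : \sum_(d : bool * ('I_N * 'I_N)) K (d.1, (val d.2.1, val d.2.2)) = 0.
  rewrite -[RHS](grid_coboundary_orthogonal x w0).
  by under [RHS]eq_bigr do rewrite pair_bigA; rewrite pair_bigA.
have WE u p : W u p -> w p = (v == u)%:R.
  move=> Wu; congr (_%:R); congr (nat_of_bool _).
  by apply/idP/eqP => [Wv|->//]; exact: W_disj Wv Wu.
pose a' e : bool * ('I_N * 'I_N) :=
  ((a e).1, (Ordinal (a_lt1 e), Ordinal (a_lt2 e))).
have a'E e : ((a' e).1, (val (a' e).2.1, val (a' e).2.2)) = a e.
  by rewrite /a' /=; case: (a e) => b [i j].
have a'_inj : injective a'.
  by move=> e f aef; apply: a_inj; rewrite -!a'E aef.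
rewrite -[RHS]K0 [RHS](bigID (mem (a' @: [set: I]))) /= [X in _ = _ + X]big1.
  rewrite addr0 big_imset /=; last by move=> e f _ _; exact: a'_inj.
  rewrite [LHS]big_mkcond /=; apply: eq_big => [e|e _]; first by rewrite inE.
  rewrite (a'E e) F2_addb /K; have [u [u' [uu' -> /WE -> /WE ->]]] := aP e.
  rewrite -[X in _ = _ * X]F2_addb !inE.
  case: (eqVneq v u) => [vu|_]; case: (eqVneq v u') => [vu'|_] /=;
    rewrite ?mulr1 ?mulr0 //.
  by rewrite -vu -vu' eqxx in uu'.
move=> d dNa; set d' := (d.1, _).
have [|Sd] := boolP (S d').
  case/orP=> /existsP[u]; first by case/andP=> /WE ud /WE ud'; rewrite /K ud ud' F2_addxx mulr0.
  move/eqP=> aud; case/negP: dNa; apply/imsetP; exists u => //.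
  move: aud; rewrite -a'E /d'; case: (a' u) (d) => b [i j] [b1 [i1 j1]] /=.
  by case=> -> /val_inj -> /val_inj ->.
rewrite /K /x (_ : fingraph.root merged (cell (face1 d')) = fingraph.root merged (cell (face2 d'))).
  by rewrite F2_addxx mul0r.
apply/eqP; rewrite (root_connect merged_sym); apply: connect1.
by apply/existsP; exists d; apply/andP; split=> //; rewrite eqxx.
Qed.

Lemma grid_minor_edge_bound (g : nat) :
  (forall B : {set I}, B != finset.set0 ->
     (forall v, ~~ odd #|[set e in B | v \in ends e]|) -> g <= #|B|)%N ->
  (#|I| <= #|T|.-1 \/ g * (#|I| + 2) <= 2 * #|I| + g * #|T|)%N.
Proof.
apply: (dual_edge_bound _ _ boundary_even).
  by move=> e; have [u [v [uv -> _ _]]] := aP e; rewrite cards2 uv.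
move=> z /lift_cycle[f [fa fS]].
exists (fun k => f (val k.1, val k.2)) => e; rewrite fa.
have inv p : (p.1 <= N)%N -> (p.2 <= N)%N ->
    f (val (fingraph.root merged (cell p)).1, val (fingraph.root merged (cell p)).2) = f p.
  move=> p1 p2; rewrite -[in RHS](cellK p1 p2); apply/esym/(merged_invariant fS).
  exact: connect_root.
have /and4P[e1 e1N e2 e2N] := a_range e.
by rewrite !inv // /face1 /face2 //=; case: (a e).1 => /=; lia.
Qed.
End GridMinor.

Definition grid_conn (S : pred (nat * nat)) (p q : nat * nat) : Prop :=
  exists s, path (fun p p' => [&& grid_adj p p', S p & S p']) p s /\ last p s = q.

Lemma grid_adj_sym : symmetric grid_adj.
Proof. by move=> p q; apply: eq_existsb => b; rewrite orbC. Qed.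

Lemma grid_conn_refl S p : grid_conn S p p.
Proof. by exists [::]. Qed.

Lemma grid_conn_trans S q p r :
  grid_conn S p q -> grid_conn S q r -> grid_conn S p r.
Proof.
by move=> [s [ps <-]] [s' [qs' <-]]; exists (s ++ s'); rewrite cat_path last_cat ps.
Qed.

Lemma grid_conn1 (S : pred (nat * nat)) p q :
  grid_adj p q -> S p -> S q -> grid_conn S p q.
Proof. by move=> pq Sp Sq; exists [:: q]; rewrite /= pq Sp Sq. Qed.

Lemma grid_conn_ind (S : pred (nat * nat)) (P : nat * nat -> nat * nat -> Prop) :
  (forall p, P p p) ->
  (forall p q r, grid_adj p q -> S p -> S q -> P q r -> P p r) ->
  forall p q, grid_conn S p q -> P p q.
Proof.
move=> P0 PS p q [s [+ <-]]; elim: s p => //= r s IHs p.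
by move=> /andP[/and3P[pr Sp Sr] rs]; apply: PS pr Sp Sr (IHs _ rs).
Qed.

Lemma grid_conn_sym S p q : grid_conn S p q -> grid_conn S q p.
Proof.
move: p q; apply: grid_conn_ind => [p|p q r pq Sp Sq rq].
  exact: grid_conn_refl.
by apply: grid_conn_trans rq _; apply: grid_conn1; rewrite // grid_adj_sym.
Qed.

Lemma grid_conn_sub (S S' : pred (nat * nat)) p q : subpred S S' ->
  grid_conn S p q -> grid_conn S' p q.
Proof.
move=> SS'; move: p q; apply: grid_conn_ind => [p|p q r pq /SS' Sp /SS' Sq].
  exact: grid_conn_refl.
by apply: grid_conn_trans; exact: grid_conn1.
Qed.

Lemma grid_conn_exit S (A : pred (nat * nat)) p q : grid_conn S p q ->
  A p -> ~~ A q -> exists p' q', [/\ grid_adj p' q', S p', S q', A p' & ~~ A q'].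
Proof.
move: p q; apply: grid_conn_ind => [p Ap|p q r pq Sp Sq IH Ap Ar].
  by rewrite Ap.
have [Aq|Aq] := boolP (A q); first exact: IH.
by exists p, q.
Qed.

(** * Branch sets made of the pixels of a drawing *)

Section PixelDrawing.
Variables (T I : finType) (src tgt : I -> T) (c : T -> nat * nat) (N : nat).
(* Pixels met by the first, middle and last third of each edge. *)
Variable P : I -> 'I_3 -> pred (nat * nat).
Let ends e := [set src e; tgt e]%SET.
Let p0 : 'I_3 := inord 0.
Let p1 : 'I_3 := inord 1.
Let p2 : 'I_3 := inord 2.
Let at_end e k v := (k == p0) && (v == src e) || (k == p2) && (v == tgt e).

Hypothesis ends_inj : injective ends.
Hypothesis st : forall e, src e != tgt e.
Hypothesis P_bound : forall e k p, P e k p ->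
  [&& 0 < p.1, p.1 < N, 0 < p.2 & p.2 < N]%N.
Hypothesis P_conn : forall e k p q, P e k p -> P e k q -> grid_conn (P e k) p q.
Hypothesis P_join : forall e,
  (exists2 q, P e p0 q & P e p1 q) /\ (exists2 q, P e p1 q & P e p2 q).
Hypothesis P_end : forall e k v, at_end e k v -> P e k (c v).
Hypothesis P_sep_ends : forall e f k l u v p, at_end e k u -> at_end f l v ->
  P e k p -> P f l p -> u = v.
Hypothesis P_sep_mid : forall e f p, P e p1 p -> P f p1 p -> e = f.
Hypothesis P_sep_mid_end : forall e f l v p, at_end f l v -> P e p1 p ->
  P f l p -> v \in ends e.

Let star v p := [exists e, exists k, at_end e k v && P e k p].
(** Middle thirds are given to the source of their edge, except for pixels that the target already
    owns; this keeps the sets disjoint. *)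
Let D v p := star v p || [exists e, [&& src e == v, P e p1 p & ~~ star (tgt e) p]].

Let star_disj u v p : star u p -> star v p -> u = v.
Proof.
case/existsP=> e /existsP[k /andP[eku Pe]] /existsP[f /existsP[l /andP[flv Pf]]].
exact: P_sep_ends eku flv Pe Pf.
Qed.

Let D_disj u v p : D u p -> D v p -> u = v.
Proof.
suff H u' v' : star u' p -> [exists e, [&& src e == v', P e p1 p & ~~ star (tgt e) p]] ->
    u' = v'.
  case/orP=> Hu /orP[] Hv.
  - exact: star_disj Hu Hv.
  - exact: H Hu Hv.
  - by apply/esym; exact: H Hv Hu.
  case/existsP: Hu => e /and3P[/eqP <- Pe _].
  case/existsP: Hv => f /and3P[/eqP <- Pf _].
  by rewrite (P_sep_mid Pe Pf).
move=> su /existsP[e /and3P[/eqP <- Pe Ne]].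
case/existsP: (su) => f /existsP[l /andP[flu Pf]].
have := P_sep_mid_end flu Pe Pf; rewrite !inE => /orP[/eqP //|/eqP ue].
by rewrite -ue su in Ne.
Qed.

(** Taking away the pixels of the target may disconnect [D v]; the branch set is the component of
    [c v]. *)
Let W v p : bool := D v p && `[< grid_conn (D v) (c v) p >].

Let W_bound v p : W v p -> [&& 0 < p.1, p.1 < N, 0 < p.2 & p.2 < N]%N.
Proof.
case/andP=> /orP[/existsP[e /existsP[k /andP[_ /P_bound]]] _ //|].
by case/existsP=> e /and3P[_ /P_bound].
Qed.

Let W_disj u v p : W u p -> W v p -> u = v.
Proof. by move=> /andP[Du _] /andP[Dv _]; exact: D_disj Du Dv. Qed.

Let W_conn v p : W v p -> grid_conn (W v) (c v) p.
Proof.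
case/andP=> Dp /asboolP; move: Dp.
suff H q : grid_conn (D v) q p -> D v p -> grid_conn (D v) (c v) q ->
    grid_conn (W v) q p.
  by move=> Dp /H; apply => //; exact: grid_conn_refl.
move: q p; apply: grid_conn_ind => [q _ _|q r p qr Dq Dr IH Dp cq].
  exact: grid_conn_refl.
have cr : grid_conn (D v) (c v) r by apply: grid_conn_trans cq (grid_conn1 qr Dq Dr).
apply: grid_conn_trans (IH Dp cr); apply: grid_conn1 => //.
  by rewrite /W Dq; apply/asboolP.
by rewrite /W Dr; apply/asboolP.
Qed.

Let end_W e k v p : at_end e k v -> P e k p -> W v p.
Proof.
move=> ekv Pp.
have PD : subpred (P e k) (D v).
  by move=> q Pq; apply/orP; left; apply/existsP; exists e; apply/existsP; exists k; rewrite ekv.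
rewrite /W PD //=; apply/asboolP/(grid_conn_sub PD)/P_conn => //.
exact: P_end.
Qed.

(** Walk along the middle third, from a pixel shared with the first third to one shared with the
    last. The first pixel [q] outside [W (src e)] must be in the star of the target, since otherwise
    it would be in [D (src e)] and connected to [c (src e)]. *)
Let edge_crossing e : exists d : bool * (nat * nat), exists u v,
  [/\ u != v, ends e = [set u; v]%SET, W u d.2 & W v (grid_end d)].
Proof.
have [[q1 q1a q1b] [q2 q2a q2b]] := P_join e.
have src0 : at_end e p0 (src e) by rewrite /at_end !eqxx.
have tgt2 : at_end e p2 (tgt e) by rewrite /at_end !eqxx orbT.
have Wq1 : W (src e) q1 := end_W src0 q1a.
have Wq2 : ~~ W (src e) q2.
  apply: contra (st e) => Wq2; apply/eqP; apply: W_disj Wq2 (end_W tgt2 q2b).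
have [p [q [pq Pp Pq Wp Wq]]] := grid_conn_exit (P_conn q1b q2a) Wq1 Wq2.
have Wtq : W (tgt e) q.
  have [/existsP[f /existsP[l /andP[flt Pf]]]|Nq] := boolP (star (tgt e) q).
    exact: end_W flt Pf.
  case/negP: Wq.
  have Dq : D (src e) q.
    by apply/orP; right; apply/existsP; exists e; rewrite eqxx Pq Nq.
  rewrite /W Dq; apply/asboolP; case/andP: Wp => Dp /asboolP cp.
  by apply: grid_conn_trans cp (grid_conn1 pq Dp Dq).
case/existsP: pq => b /orP[/eqP qE|/eqP pE].
  by exists (b, p), (src e), (tgt e); rewrite -qE.
exists (b, q), (tgt e), (src e); rewrite -pE; split=> //; first by rewrite eq_sym.
by rewrite /ends finset.setUC.
Qed.

Lemma pixel_drawing_edge_bound (g : nat) :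
  (forall B : {set I}, B != finset.set0 ->
     (forall v, ~~ odd #|[set e in B | v \in ends e]|) -> g <= #|B|)%N ->
  (#|I| <= #|T|.-1 \/ g * (#|I| + 2) <= 2 * #|I| + g * #|T|)%N.
Proof.
have [a aP] := choice edge_crossing.
exact: (grid_minor_edge_bound ends_inj W_bound W_disj W_conn aP).
Qed.
End PixelDrawing.

(** * From drawings to grid minors *)

Section Segment.
Variable R : realType.
Implicit Types a b t u v e d : R.

(** Consider the supremum of the points up to which [P] holds; the local condition carries [P] past
    it. *)
Lemma segment_induction a b (P : R -> Prop) : P a ->
  (forall t, a <= t <= b -> exists2 e, 0 < e & forall u v,
     a <= u <= b -> a <= v <= b -> `|u - t| < e -> `|v - t| < e ->
     P u -> P v) ->
  forall t, a <= t <= b -> P t.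
Proof.
move=> Pa Ploc t0 t0ab.
pose S := [set t | a <= t <= b /\ forall u, a <= u <= t -> P u]%classic.
have Sa : S a.
  split=> [|u au]; first lra.
  by have -> : u = a by lra.
have Sub : has_sup S by split; [exists a|exists b => t -[/andP[]]].
have supa : a <= sup S by apply: ub_le_sup => //; exact: Sub.2.
have supb : sup S <= b by apply: ge_sup; [exists a|move=> t [/andP[]]].
have [e e0 He] := Ploc (sup S) ltac:(lra).
have [t [tab Pt] tsup] := sup_adherent e0 Sub.
have tS : t <= sup S by apply: ub_le_sup; [exact: Sub.2|split].
have near_sup u : a <= u <= b -> u < sup S + e -> P u.
  move=> uab us; have [ut|ut] := leP u t; first by apply: Pt; lra.
  apply: (He t) => //; last by apply: Pt; lra.
    by rewrite ltr_norml; lra.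
  by rewrite ltr_norml; lra.
apply: (near_sup) => //; suff : b <= sup S by lra.
rewrite leNgt; apply/negP => supltb.
have [lt_e|lt_e] := leP (sup S + e / 2) b.
  have : sup S + e / 2 <= sup S.
    apply: ub_le_sup; first exact: Sub.2.
    by split=> [|u uS]; [lra|apply: near_sup; lra].
  lra.
have : b <= sup S.
  apply: ub_le_sup; first exact: Sub.2.
  by split=> [|u uS]; [lra|apply: near_sup; lra].
lra.
Qed.

Lemma segment_uniform a b (Q : R -> R -> Prop) :
  (forall t d e, 0 < d -> d <= e -> Q e t -> Q d t) ->
  (forall t, a <= t <= b -> exists d e, [/\ 0 < d, 0 < e & forall u,
     a <= u <= b -> `|u - t| < e -> Q d u]) ->
  exists2 d, 0 < d & forall t, a <= t <= b -> Q d t.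
Proof.
move=> Qanti Qloc; have [ab|ba] := leP a b; last first.
  by exists 1 => // t; lra.
pose P t := exists2 d, 0 < d & forall u, a <= u <= t -> Q d u.
apply: (@segment_induction a b P _ _ b); last by rewrite ab lexx.
  have [d [e [d0 e0 He]]] := Qloc a ltac:(lra).
  exists d => // u ua; apply: He; first lra.
  have -> : u - a = 0 by lra.
  by rewrite normr0.
move=> t /Qloc[d [e [d0 e0 He]]]; exists e => // u v uab vab ut vt [d' d'0 Pd'].
have [dd' dd'd dd'd'] : [/\ 0 < Num.min d d', Num.min d d' <= d & Num.min d d' <= d'].
  by rewrite lt_min d0 d'0 ge_min lexx ge_min lexx orbT.
exists (Num.min d d') => // w wav; have [wu|uw] := leP w u.
  apply: Qanti (Pd' w _) => //; lra.
apply: Qanti (He w _ _) => //; first lra.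
by move: ut vt; rewrite !ltr_norml; lra.
Qed.

Lemma finite_uniform (I : finType) (Q : R -> I -> Prop) :
  (forall i d e, 0 < d -> d <= e -> Q e i -> Q d i) ->
  (forall i, exists2 d, 0 < d & Q d i) ->
  exists2 d, 0 < d & forall i, Q d i.
Proof.
move=> Qanti Qex.
suff [d d0 Qd] : exists2 d, 0 < d & forall i, i \in enum I -> Q d i.
  by exists d => // i; apply: Qd; rewrite mem_enum.
elim: (enum I) => [|i s [d d0 IHs]]; first by exists 1.
have [e e0 Qe] := Qex i.
have de0 : 0 < Num.min d e by rewrite lt_min d0 e0.
exists (Num.min d e) => // j; rewrite inE => /orP[/eqP->|/IHs].
  by apply: Qanti Qe; rewrite // ge_min lexx orbT.
by apply: Qanti; rewrite // ge_min lexx.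
Qed.

Lemma within_continuous_eps (f : R -> R * R) a b t d :
  {within `[a, b], continuous f}%classic -> a <= t <= b -> 0 < d ->
  exists2 e, 0 < e & forall u, a <= u <= b -> `|u - t| < e ->
    `|(f u).1 - (f t).1| < d /\ `|(f u).2 - (f t).2| < d.
Proof.
move=> /subspace_continuousP cf tab d0.
have tI : `[a, b]%classic t by rewrite /= in_itv.
have : nbhs (f t) [set p : R * R | `|p.1 - (f t).1| < d /\ `|p.2 - (f t).2| < d]%classic.
  exists ([set x | `|x - (f t).1| < d], [set x | `|x - (f t).2| < d])%classic.
    split; apply/nbhs_ballP; exists d => //= x; rewrite /ball /= distrC //.
  by move=> [x y].
move=> /(cf t tI); rewrite nbhs_simpl /= /within => /nbhs_ballP[e e0 He].
exists e => // u uab ut; apply: (He u).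
  by rewrite /ball /= distrC.
by rewrite /= in_itv.
Qed.
End Segment.

Section Arcs.
Variable R : realType.
Implicit Types (f g : R -> R * R) (a b c d t u : R).

Lemma arc_bounded f : {within `[0, 1], continuous f}%classic ->
  exists2 d, 0 < d & forall t, 0 <= t <= 1 ->
    `|(f t).1| * d <= 1 /\ `|(f t).2| * d <= 1.
Proof.
move=> cf; apply: segment_uniform => [t d e d0 de [H1 H2]|t t01].
  by split; [apply: le_trans H1|apply: le_trans H2]; rewrite ler_wpM2l.
have [e e0 He] := within_continuous_eps cf t01 ltr01.
pose M := `|(f t).1| + `|(f t).2| + 1.
have [M1 M2] : 0 <= `|(f t).1| /\ 0 <= `|(f t).2| by split; exact: normr_ge0.
have M0 : 0 < M by rewrite /M; lra.
exists M^-1, e; split=> //; first by rewrite invr_gt0.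
move=> u u01 ut; have [+ +] := He u u01 ut; rewrite !ler_pdivrMr // mul1r.
have := ler_normD ((f u).1 - (f t).1) (f t).1; have := ler_normD ((f u).2 - (f t).2) (f t).2.
by rewrite !subrK /M; lra.
Qed.

Definition apart (d : R) (p q : R * R) : Prop :=
  d <= `|p.1 - q.1| \/ d <= `|p.2 - q.2|.

Lemma apart_le p q d e : d <= e -> apart e p q -> apart d p q.
Proof. by move=> de [H|H]; [left|right]; apply: le_trans de H. Qed.

Lemma apart_move p q p' q' d : apart d p q ->
  `|p'.1 - p.1| < d / 4 -> `|p'.2 - p.2| < d / 4 ->
  `|q'.1 - q.1| < d / 4 -> `|q'.2 - q.2| < d / 4 -> apart (d / 2) p' q'.
Proof.
move=> pq p1 p2 q1 q2; case: pq => H; [left|right].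
  have := ler_normD (p.1 - p'.1) (p'.1 - q'.1 + (q'.1 - q.1)).
  have := ler_normD (p'.1 - q'.1) (q'.1 - q.1).
  by rewrite (distrC p.1) (_ : _ + (_ + (_ - _)) = p.1 - q.1) 1?[RHS]addrC; [lra|ring].
have := ler_normD (p.2 - p'.2) (p'.2 - q'.2 + (q'.2 - q.2)).
have := ler_normD (p'.2 - q'.2) (q'.2 - q.2).
by rewrite (distrC p.2) (_ : _ + (_ + (_ - _)) = p.2 - q.2) 1?[RHS]addrC; [lra|ring].
Qed.

Lemma neq_apart (p q : R * R) : p <> q -> exists2 d, 0 < d & apart d p q.
Proof.
case: p q => x y [x' y'] /eqP; rewrite xpair_eqE negb_and => /orP[] H.
  by exists `|x - x'|; [rewrite normr_gt0 subr_eq0|left].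
by exists `|y - y'|; [rewrite normr_gt0 subr_eq0|right].
Qed.

(** Compactness is applied twice: to [u] for a fixed [t], then to [t]. When both points move by less
    than [r / 4], a distance [r] drops to no less than [r / 2]. *)
Lemma arcs_apart f g a b c d :
  {within `[0, 1], continuous f}%classic ->
  {within `[0, 1], continuous g}%classic ->
  0 <= a -> b <= 1 -> 0 <= c -> d <= 1 ->
  (forall t u, a <= t <= b -> c <= u <= d -> f t <> g u) ->
  exists2 r, 0 < r & forall t u, a <= t <= b -> c <= u <= d -> apart r (f t) (g u).
Proof.
move=> cf cg a0 b1 c0 d1 fg.
suff [r r0 Hr] : exists2 r, 0 < r & forall t, a <= t <= b ->
    forall u, c <= u <= d -> apart r (f t) (g u).
  by exists r => // t u tab; exact: Hr.
apply: segment_uniform => [t r s _ rs H u ucd|t tab].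
  exact: apart_le rs (H u ucd).
have [r r0 Hr] : exists2 r, 0 < r & forall u, c <= u <= d -> apart r (f t) (g u).
  apply: segment_uniform => [u r s _|u ucd]; first exact: apart_le.
  have [r r0 Hr] := neq_apart (fg t u tab ucd).
  have [|e e0 He] := @within_continuous_eps R g 0 1 u (r / 4) cg _ ltac:(lra).
    by lra.
  exists (r / 2), e; split=> [||v vcd vu]; [lra|by []|].
  have [v1 v2] := He v ltac:(lra) vu.
  by apply: apart_move Hr _ _ _ _; rewrite ?subrr ?normr0 //; lra.
have [|e e0 He] := @within_continuous_eps R f 0 1 t (r / 4) cf _ ltac:(lra).
  by lra.
exists (r / 2), e; split=> [||v vab vt u ucd]; [lra|by []|].
have [v1 v2] := He v ltac:(lra) vt.
by apply: apart_move (Hr u ucd) _ _ _ _; rewrite ?subrr ?normr0 //; lra.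
Qed.

(** The radius 2 allows an error of 1 from truncation and a further 1 from a small move along the
    arc. *)
Definition near_pixel (x y : R) (p : nat * nat) : bool :=
  (`|p.1%:R - x| <= 2) && (`|p.2%:R - y| <= 2).

Lemma near_pixel_conn x y p q : near_pixel x y p -> near_pixel x y q ->
  grid_conn (near_pixel x y) p q.
Proof.
have hor n i j : near_pixel x y (i, j) -> near_pixel x y ((i + n)%N, j) ->
    grid_conn (near_pixel x y) (i, j) ((i + n)%N, j).
  elim: n i => [|n IHn] i; first by rewrite addn0 => *; exact: grid_conn_refl.
  rewrite addnS -addSn => Hi Hn.
  have Hi1 : near_pixel x y (i.+1, j).
    move: Hi Hn; rewrite /near_pixel /= => /andP[+ ->] /andP[+ _].
    rewrite !andbT !ler_norml natrD -natr1 => Hi Hn.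
    have := ler0n R n; lra.
  apply: grid_conn_trans (IHn _ Hi1 Hn); apply: grid_conn1 => //.
  by apply/existsP; exists false; rewrite /grid_end /= eqxx.
have ver n i j : near_pixel x y (i, j) -> near_pixel x y (i, (j + n)%N) ->
    grid_conn (near_pixel x y) (i, j) (i, (j + n)%N).
  elim: n j => [|n IHn] j; first by rewrite addn0 => *; exact: grid_conn_refl.
  rewrite addnS -addSn => Hj Hn.
  have Hj1 : near_pixel x y (i, j.+1).
    move: Hj Hn; rewrite /near_pixel /= => /andP[-> +] /andP[_ +].
    rewrite /= !ler_norml natrD -natr1 => Hj Hn.
    have := ler0n R n; lra.
  apply: grid_conn_trans (IHn _ Hj1 Hn); apply: grid_conn1 => //.
  by apply/existsP; exists true; rewrite /grid_end /= eqxx.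
case: p q => i j [i' j'] Hp Hq.
have Hm : near_pixel x y (i', j).
  by move: Hp Hq; rewrite /near_pixel /= => /andP[_ ->] /andP[-> _].
apply: (@grid_conn_trans _ (i', j)).
  have [le|/ltnW le] := leqP i i'.
    by rewrite -(subnKC le) in Hm *; exact: hor.
  by apply: grid_conn_sym; rewrite -(subnKC le) in Hp *; exact: hor.
have [le|/ltnW le] := leqP j j'.
  by rewrite -(subnKC le) in Hq *; exact: ver.
by apply: grid_conn_sym; rewrite -(subnKC le) in Hm *; exact: ver.
Qed.
End Arcs.

Section DrawingPixels.
Variables (R : realType) (T I : finType) (src tgt : I -> T).
Variables (pos : T -> R * R) (gam : I -> R -> R * R).
Let ends e := [set src e; tgt e]%SET.
Hypothesis ends_inj : injective ends.
Hypothesis st : forall e, src e != tgt e.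
Hypothesis gam_cont : forall e, {within `[0, 1], continuous (gam e)}%classic.
Hypothesis gam_inj : forall e t u, 0 <= t <= 1 -> 0 <= u <= 1 ->
  gam e t = gam e u -> t = u.
Hypothesis gam0 : forall e, gam e 0 = pos (src e).
Hypothesis gam1 : forall e, gam e 1 = pos (tgt e).
Hypothesis pos_inj : forall e f u v, u \in ends e -> v \in ends f ->
  pos u = pos v -> u = v.
Hypothesis gam_pos : forall e f v t, v \in ends f -> 0 < t < 1 -> gam e t <> pos v.
Hypothesis gam_gam : forall e f t u, e != f -> 0 < t < 1 -> 0 < u < 1 ->
  gam e t <> gam f u.

Let p0 : 'I_3 := inord 0.
Let p1 : 'I_3 := inord 1.
Let p2 : 'I_3 := inord 2.
Let at_end e k v := (k == p0) && (v == src e) || (k == p2) && (v == tgt e).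
Let piece (k : 'I_3) (t : R) := k%:R / 3 <= t <= k.+1%:R / 3.

Let piece01 k t : piece k t -> 0 <= t <= 1.
Proof.
rewrite /piece; have := ler0n R k; have : k.+1%:R <= 3 :> R by rewrite ler_nat.
by move=> k3 k0 /andP[H1 H2]; lra.
Qed.

Let mid01 t : piece p1 t -> 0 < t < 1.
Proof. by rewrite /piece inordK //; lra. Qed.

Let endP e k v t : at_end e k v -> piece k t ->
  v \in ends e /\ (0 < t < 1 \/ gam e t = pos v).
Proof.
case/orP=> /andP[/eqP-> /eqP->]; rewrite /piece inordK // => tk;
  rewrite !inE eqxx ?orbT; split=> //.
  have [->|t0] := eqVneq t 0; first by right; rewrite gam0.
  by left; rewrite lt_neqAle eq_sym t0 /=; lra.
have [->|t0] := eqVneq t 1; first by right; rewrite gam1.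
by left; rewrite [X in _ && X]lt_neqAle t0 /=; lra.
Qed.

Let sep_mid e f t u : e != f -> piece p1 t -> piece p1 u -> gam e t <> gam f u.
Proof. by move=> ef /mid01 t01 /mid01 u01; exact: gam_gam. Qed.

Let sep_mid_end e f l v t u : at_end f l v -> v \notin ends e ->
  piece p1 t -> piece l u -> gam e t <> gam f u.
Proof.
move=> flv ve /mid01 t01 lu; have [vf [u01|->]] := endP flv lu; last exact: gam_pos vf t01.
by apply: gam_gam => //; apply: contraNneq ve => ->.
Qed.

Let sep_ends e f k l u v s t : at_end e k u -> at_end f l v -> u != v ->
  piece k s -> piece l t -> gam e s <> gam f t.
Proof.
move=> eku flv uv ks lt.
have [ef|ef] := eqVneq e f; last first.
  have [ue [s01|->]] := endP eku ks; have [vf [t01|->]] := endP flv lt.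
  - exact: gam_gam.
  - exact: gam_pos vf s01.
  - by apply/nesym; exact: gam_pos ue t01.
  - by move/(pos_inj ue vf) => uv'; rewrite uv' eqxx in uv.
subst f => /(gam_inj (piece01 ks) (piece01 lt)) st'; subst t.
move: eku flv uv ks lt; rewrite /piece.
case/orP=> /andP[/eqP-> /eqP->] /orP[] /andP[/eqP-> /eqP->];
  rewrite ?eqxx // !inordK //; lra.
Qed.

Let sepd (e : I) (k : 'I_3) (f : I) (l : 'I_3) :=
  forall t u, piece k t -> piece l u -> gam e t <> gam f u.

(** There are finitely many pairs of thirds, and each disjoint pair is at positive distance. *)
Let exists_mesh : exists2 d : R, 0 < d & forall (x : (I * 'I_3) * (I * 'I_3)),
  sepd x.1.1 x.1.2 x.2.1 x.2.2 -> forall t u, piece x.1.2 t -> piece x.2.2 u ->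
  apart d (gam x.1.1 t) (gam x.2.1 u).
Proof.
apply: finite_uniform => [x d e _ de H sx t u kt lu|[[e k] [f l]] /=].
  exact: apart_le de (H sx t u kt lu).
have [sx|nsx] := pselect (sepd e k f l); last by exists 1.
have bnd (j : 'I_3) : 0 <= j%:R / 3 :> R /\ j.+1%:R / 3 <= 1 :> R.
  have := ler0n R j; have : j.+1%:R <= 3 :> R by rewrite ler_nat.
  by lra.
have [d d0 Hd] := arcs_apart (@gam_cont e) (@gam_cont f) (bnd k).1 (bnd k).2
  (bnd l).1 (bnd l).2 sx.
by exists d.
Qed.

Let exists_bound : exists2 d : R, 0 < d & forall e t, 0 <= t <= 1 ->
  `|(gam e t).1| * d <= 1 /\ `|(gam e t).2| * d <= 1.
Proof.
apply: (finite_uniform (Q := fun d e => forall t, 0 <= t <= 1 ->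
  `|(gam e t).1| * d <= 1 /\ `|(gam e t).2| * d <= 1)) => [e d d' d0 dd' H t t01|e].
  have [H1 H2] := H t t01.
  by split; [apply: le_trans H1|apply: le_trans H2]; rewrite ler_wpM2l.
exact: arc_bounded.
Qed.

Lemma drawing_edge_bound (g : nat) :
  (forall B : {set I}, B != finset.set0 ->
     (forall v, ~~ odd #|[set e in B | v \in ends e]|) -> g <= #|B|)%N ->
  (#|I| <= #|T|.-1 \/ g * (#|I| + 2) <= 2 * #|I| + g * #|T|)%N.
Proof.
have [d d0 Hd] := exists_mesh; have [b b0 Hb] := exists_bound.
(* Points near a common pixel differ by at most 4 in each scaled coordinate, so by at most [4 * s],
   which is less than [d]. *)
pose s := d / 5; pose M := b^-1.
have s0 : 0 < s by rewrite /s; lra.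
(* [M] bounds all coordinates, so [X] is at least 4 and pixels within 2 of it stay off the axes. *)
pose X (p : R * R) := (p.1 + M) / s + 4.
pose Y (p : R * R) := (p.2 + M) / s + 4.
have [Xb Yb] : (forall e t, 0 <= t <= 1 -> 4 <= X (gam e t) <= 2 * M / s + 4)
    /\ (forall e t, 0 <= t <= 1 -> 4 <= Y (gam e t) <= 2 * M / s + 4).
  suff H (x : R) : `|x| * b <= 1 -> 4 <= (x + M) / s + 4 <= 2 * M / s + 4.
    by split=> e t /(Hb e)[H1 H2]; exact: H.
  rewrite -ler_pdivlMr // mul1r -/M ler_norml => /andP[x1 x2].
  have : 0 <= (x + M) / s by apply: divr_ge0; [lra|exact: ltW].
  have : (x + M) / s <= 2 * M / s by rewrite ler_pM2r ?invr_gt0 //; lra.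
  lra.
pose pix (p : R * R) := (Num.trunc (X p), Num.trunc (Y p)).
pose P e (k : 'I_3) (p : nat * nat) :=
  `[< exists2 t, piece k t & near_pixel (X (gam e t)) (Y (gam e t)) p >].
have trunc_near (x : R) : 0 <= x -> x - 1 < (Num.trunc x)%:R <= x.
  by move=> /truncn_itv /andP[H1]; rewrite -natr1; lra.
have pix_near e t : 0 <= t <= 1 -> near_pixel (X (gam e t)) (Y (gam e t)) (pix (gam e t)).
  move=> t01; have := Xb e t t01; have := Yb e t t01 => Y0 X0.
  have X1 := trunc_near (X (gam e t)) ltac:(lra).
  have Y1 := trunc_near (Y (gam e t)) ltac:(lra).
  by rewrite /near_pixel /pix !ler_norml; apply/andP; split; move: X1 Y1 => /=; lra.
pose N := (Num.trunc (2 * M / s + 6)).+1.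
have P_bound e k p : P e k p -> [&& 0 < p.1, p.1 < N, 0 < p.2 & p.2 < N]%N.
  case/asboolP => t /piece01 t01 /andP[]; rewrite !ler_norml => p1x p2y.
  have := Xb e t t01; have := Yb e t t01 => Yt Xt.
  have pN (n : nat) : n%:R <= 2 * M / s + 6 -> (n < N)%N.
    by move=> nM; rewrite /N ltnS truncn_ge_nat //; have := ler0n R n; lra.
  have p_gt0 (n : nat) : 2 <= n%:R :> R -> (0 < n)%N by rewrite lt0n; case: eqP => // ->; lra.
  by rewrite !pN ?p_gt0 //; lra.
have P_conn e k p q : P e k p -> P e k q -> grid_conn (P e k) p q.
  case/asboolP=> t kt pt /asboolP[u ku qu].
  have nP v : piece k v -> subpred (near_pixel (X (gam e v)) (Y (gam e v))) (P e k).
    by move=> kv r rv; apply/asboolP; exists v.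
  apply: (@grid_conn_trans _ (pix (gam e t))).
    by apply: grid_conn_sub (nP _ kt) _; apply: near_pixel_conn pt (pix_near _ _ (piece01 kt)).
  apply: (@grid_conn_trans _ (pix (gam e u))); last first.
    by apply: grid_conn_sub (nP _ ku) _; apply: near_pixel_conn (pix_near _ _ (piece01 ku)) qu.
  suff conn0 v : piece k v -> grid_conn (P e k) (pix (gam e (k%:R / 3))) (pix (gam e v)).
    by apply: grid_conn_trans (conn0 u ku); apply/grid_conn_sym/conn0.
  move: v; apply: (@segment_induction _ _ _
    (fun v => grid_conn (P e k) _ (pix (gam e v)))) => [|w kw].
    exact: grid_conn_refl.
  have [r r0 Hr] := within_continuous_eps (@gam_cont e) (piece01 kw) (ltac:(lra) : 0 < s / 2).
  exists r => // v1 v2 kv1 kv2 /(Hr _ (piece01 kv1))[x1 y1] /(Hr _ (piece01 kv2))[x2 y2].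
  move=> c1; apply: grid_conn_trans c1 _; apply: grid_conn_sub (nP _ kv2) _.
  apply: near_pixel_conn (pix_near _ _ (piece01 kv2)).
  (* The pixel of a point on the arc is also near any other point of the arc close to it, which
     links consecutive pixels. *)
  have close (x y z : R) : `|x - z| < s / 2 -> `|y - z| < s / 2 ->
      4 <= (x + M) / s + 4 ->
      `|(Num.trunc ((x + M) / s + 4))%:R - ((y + M) / s + 4)| <= 2.
    rewrite !ltr_norml => xz yz x0.
    have := trunc_near ((x + M) / s + 4) ltac:(lra).
    have xy : `|(x + M) / s - (y + M) / s| <= 1.
      rewrite -mulrBl normrM (gtr0_norm (_ : 0 < s^-1)) ?invr_gt0 // ler_pdivrMr // mul1r.
      by rewrite ler_norml; lra.
    by move: xy; rewrite !ler_norml; lra.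
  have := Xb e v1 (piece01 kv1); have := Yb e v1 (piece01 kv1) => Y4 X4.
  rewrite /near_pixel; apply/andP; split.
    by apply: close x1 x2 _; case/andP: X4.
  by apply: close y1 y2 _; case/andP: Y4.
have P_join e : (exists2 q, P e p0 q & P e p1 q) /\ (exists2 q, P e p1 q & P e p2 q).
  have J (t : R) (k : 'I_3) : 0 <= t <= 1 -> piece k t -> P e k (pix (gam e t)).
    by move=> t01 kt; apply/asboolP; exists t => //; exact: pix_near.
  split; [exists (pix (gam e (1 / 3)))|exists (pix (gam e (2 / 3)))];
    by apply: J; rewrite ?/piece ?inordK //; lra.
have P_end e k v : at_end e k v -> P e k (pix (pos v)).
  case/orP=> /andP[/eqP-> /eqP->]; apply/asboolP.
    by exists 0; [rewrite /piece inordK //; lra|rewrite -gam0; apply: pix_near; lra].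
  by exists 1; [rewrite /piece inordK //; lra|rewrite -gam1; apply: pix_near; lra].
have P_sep e k f l p : P e k p -> P f l p -> ~ sepd e k f l.
  case/asboolP=> t kt pt /asboolP[u lu pu] ef.
  have close (x y : R) (n : nat) : `|n%:R - ((x + M) / s + 4)| <= 2 ->
      `|n%:R - ((y + M) / s + 4)| <= 2 -> `|x - y| < d.
    move=> nx ny; have xy : `|(x + M) / s - (y + M) / s| <= 4.
      by move: nx ny; rewrite !ler_norml; lra.
    move: xy; rewrite -mulrBl normrM (gtr0_norm (_ : 0 < s^-1)) ?invr_gt0 //.
    rewrite ler_pdivrMr //; rewrite (_ : x + M - (y + M) = x - y); last by ring.
    by rewrite /s; lra.
  move: pt pu => /andP[px py] /andP[qx qy].
  have := Hd (e, k, (f, l)) ef t u kt lu; case; rewrite leNgt /=.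
    by rewrite (close _ _ _ px qx).
  by rewrite (close _ _ _ py qy).
apply: (pixel_drawing_edge_bound ends_inj st P_bound P_conn P_join P_end).
- move=> e f k l u v p eku flv Pe Pf; apply/eqP; apply: contraT => uv.
  by case: (P_sep _ _ _ _ _ Pe Pf) => t t'; exact: sep_ends eku flv uv.
- move=> e f p Pe Pf; apply/eqP; apply: contraT => ef.
  by case: (P_sep _ _ _ _ _ Pe Pf) => t t'; exact: sep_mid ef.
- move=> e f l v p flv Pe Pf; apply: contraT => ve.
  by case: (P_sep _ _ _ _ _ Pe Pf) => t t'; exact: sep_mid_end flv ve.
Qed.
End DrawingPixels.

(** * Lower bound *)

Lemma girth_geqP (T : finType) (g : nat) (G : sgraph T) :
  girth_geq g G <-> (forall k, has_cycle G k -> (g <= k)%N).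
Proof.
rewrite /girth_geq /girth /nat_min; case: pselect => [exk|nex].
  case: ex_minnP => k /asboolP Gk kmin; split=> [gk j Gj|]; last exact.
  by apply: leq_trans gk (kmin j _); apply/asboolP.
by split=> // _ k Gk; case: nex; exists k; apply/asboolP.
Qed.

Lemma planar_edge_bound (R : realType) (T : finType) (g : nat) (G : sgraph T) :
  planar R G -> girth_geq g G ->
  (#|eset G| <= #|T|.-1 \/
   g * (#|eset G| + 2) <= 2 * #|eset G| + g * #|T|)%N.
Proof.
move=> [pos [gamma [pos_inj gammaP gamma_pos gamma_gamma]]] /girth_geqP Gg.
have eP e : e \in eset G -> e \subset vset G /\ #|e| = 2%N.
  by move/(forall_inP (esetP G)) => /andP[? /eqP].
pose I : finType := {e : {set T} | e \in eset G}.
have cardI : #|I| = #|eset G| by rewrite card_sig.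
have in01 (t : R) : (t \in `[0, 1]%R) = (0 <= t <= 1) by rewrite in_itv.
have oo01 (t : R) : (t \in `]0, 1[%R) = (0 < t < 1) by rewrite in_itv.
(* A drawing prescribes only the set of ends of an arc; the source is the end at parameter 0. *)
have ori (e : I) : exists uv : T * T, [/\ uv.1 != uv.2,
    val e = [set uv.1; uv.2]%SET, gamma (val e) 0 = pos uv.1 & gamma (val e) 1 = pos uv.2].
  have [/fintype.subsetP eV /eqP/cards2P[u [v [uv eE]]]] := eP _ (valP e).
  have [_ ginj gend] := gammaP _ (valP e).
  have g01 : gamma (val e) 0 <> gamma (val e) 1.
    move=> /ginj; rewrite !in01 => /(_ ltac:(lra) ltac:(lra)); lra.
  have gE (x : R * R) : x = gamma (val e) 0 \/ x = gamma (val e) 1 ->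
      x = pos u \/ x = pos v.
    move=> xg; have : [set gamma (val e) 0; gamma (val e) 1]%classic x by [].
    rewrite gend => -[y + <-]; rewrite /= eE !inE => /orP[/eqP->|/eqP->]; tauto.
  have [g0|g0] := gE _ (or_introl erefl); have [g1|g1] := gE _ (or_intror erefl).
  - by rewrite g0 g1 in g01.
  - by exists (u, v).
  - by exists (v, u); rewrite /= eq_sym finset.setUC.
  - by rewrite g0 g1 in g01.
have [uv uvP] := choice ori.
pose src e := (uv e).1; pose tgt e := (uv e).2.
have endsE e : [set src e; tgt e]%SET = val e by have [_ ->] := uvP e.
have inV (e : I) v : v \in [set src e; tgt e]%SET -> v \in vset G.
  by rewrite endsE; have [/fintype.subsetP eV _] := eP _ (valP e); exact: eV.
have := @drawing_edge_bound R T I src tgt pos (fun e => gamma (val e)) _ _ _ _ _ _ _ _ _ g.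
rewrite cardI; apply.
- by move=> e f; rewrite !endsE => /val_inj.
- by move=> e; have [] := uvP e.
- by move=> e; have [] := gammaP _ (valP e).
- move=> e t u t01 u01; have [_ + _] := gammaP _ (valP e); apply; rewrite ?in01 //.
- by move=> e; have [] := uvP e.
- by move=> e; have [] := uvP e.
- by move=> e f u v /inV uG /inV vG; exact: pos_inj.
- move=> e f v t /inV vG t01; apply: gamma_pos; rewrite ?oo01 //; exact: valP.
- move=> e f t u ef t01 u01; apply: gamma_gamma; rewrite ?oo01 //; exact: valP.
move=> B /finset.set0Pn[e0 e0B] B_even.
pose B' : {set {set T}} := [set val e | e in B]%SET.
have cardB : #|B'| = #|B| by rewrite card_imset //; exact: val_inj.
have [|v||c [c3 cB /andP[cc Uc]]] := @even_subgraph_cycle T B'.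
- by move=> _ /imsetP[e _ ->]; have [] := eP _ (valP e).
- rewrite (_ : [set _ in B' | _] = [set val e | e in [set e in B | v \in [set src e; tgt e]%SET]])%SET.
    by rewrite card_imset //; exact: val_inj.
  apply/setP => x; rewrite inE; apply/andP/imsetP.
    by move=> [/imsetP[e eB ->] ve]; exists e => //; rewrite inE eB endsE.
  move=> [e + ->]; rewrite inE endsE => /andP[eB ve]; split=> //.
  by apply/imsetP; exists e.
- by apply/finset.set0Pn; exists (val e0); apply/imsetP; exists e0.
rewrite -cardB; apply: leq_trans cB; apply: Gg; exists c; split=> //.
rewrite /ucycle Uc andbT; apply: sub_cycle cc => x y /imsetP[e _ xy].
by rewrite /adj xy; exact: valP.
Qed.

Lemma girth_thickness_eq (R : realType) (T : finType) (g : nat) (G : sgraph T)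
    (k : nat) :
  girth_cover R g G k -> (forall j, girth_cover R g G j -> (k <= j)%N) ->
  girth_thickness R g G = k.
Proof.
move=> Gk kmin; rewrite /girth_thickness /nat_min.
case: pselect => [exk|nex] /=; last by case: nex; exists k; apply/asboolP.
case: ex_minnP => j /asboolP Gj jmin; apply/eqP; rewrite eqn_leq kmin // jmin //.
exact/asboolP.
Qed.

Lemma card_complete_edges (n : nat) : #|eset (complete_graph n)| = 'C(n, 2).
Proof. by rewrite card_draws card_ord. Qed.

Lemma complete_cover_bound (R : realType) (n k : nat) : (4 <= n)%N ->
  girth_cover R 6 (complete_graph n) k -> (n * n.-1 <= k * (3 * (n - 2)))%N.
Proof.
move=> n4 [H [HP [_ HE]]].
have cardH i : (2 * #|eset (H i)| <= 3 * (n - 2))%N.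
  have [_ pH gH] := HP i.
  (* Euler's inequality gives [4 * E <= 6 * n - 12]; for [n >= 4] the alternative [E <= n - 1]
     satisfies the same bound. *)
  by have := planar_edge_bound pH gH; rewrite card_ord; lia.
have cardE : (#|eset (complete_graph n)| <= \sum_(i < k) #|eset (H i)|)%N.
  rewrite HE; elim/big_rec2: _ => [|i s A _ IH]; first by rewrite cards0.
  by rewrite (leq_trans (leq_card_setU _ _)) // leq_add2l.
have : (2 * #|eset (complete_graph n)| <= \sum_(i < k) (3 * (n - 2)))%N.
  rewrite (leq_trans (n := 2 * \sum_(i < k) #|eset (H i)|)) ?leq_mul2l //.
  by rewrite big_distrr leq_sum.
by rewrite sum_nat_const card_ord card_complete_edges mul_bin_left bin1 subn1 mulnC.
Qed.

Lemma complete_cover_ge1 (R : realType) (n k : nat) : (1 <= n)%N ->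
  girth_cover R 6 (complete_graph n) k -> (1 <= k)%N.
Proof.
case: n => // n _ [H [_ [/setP/(_ ord0) HV _]]].
by case: k H HV => // H; rewrite big_ord0 !inE.
Qed.

Lemma complete_graph3_cover_ge2 (R : realType) (k : nat) :
  girth_cover R 6 (complete_graph 3) k -> (2 <= k)%N.
Proof.
move=> Hk; have := complete_cover_ge1 (isT : (1 <= 3)%N) Hk.
case: k Hk => [|[|//]] // [H [HP [_ HE]]] _.
have [_ _ /girth_geqP gH] := HP ord0.
suff : (6 <= 3)%N by [].
apply: gH; exists [:: @Ordinal 3 0 isT; @Ordinal 3 1 isT; @Ordinal 3 2 isT].
split=> //; rewrite /ucycle /= andbT /adj.
have <- : eset (complete_graph 3) = eset (H ord0) by rewrite HE big_ord1.
by rewrite !inE !cards2.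
Qed.

(** * Two-page book embeddings *)

(* A two-page book embedding: the vertices are placed on a line, and each edge
   is drawn above or below the line according to its page [pg]. *)
Definition book_embedding (T : eqType) (E : rel T) (pos : T -> nat) (pg : rel T) : Prop :=
  [/\ injective pos, symmetric pg &
   forall x y u v, E x y -> E u v -> pg x y = pg u v ->
     (pos x < pos u)%N -> (pos u < pos y)%N -> (pos y < pos v)%N -> False].

Definition book6 (T : eqType) (E : rel T) : Prop :=
  [/\ symmetric E, irreflexive E, exists pos pg, book_embedding E pos pg &
   forall c, (2 < size c)%N -> ucycle E c -> (5 < size c)%N].

Section Parabola.
Variable R : realType.

(* The parabola [s * (x - a) * (b - x)], parametrized linearly in [x]. Two such
   arcs over nested intervals with the same [s] do not meet. *)
Definition parabola (a b s t : R) : R * R :=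
  (a + t * (b - a), s * ((t * (b - a)) * ((1 - t) * (b - a)))).

Lemma parabola_continuous a b s : continuous (parabola a b s).
Proof.
have c0 (c : R) : continuous (fun _ : R => c) by move=> t; exact: cvg_cst.
have c1 : continuous (fun t : R => t) by move=> t; exact: cvg_id.
have cD (f g : R -> R) : continuous f -> continuous g ->
    continuous (fun t => f t + g t).
  by move=> cf cg t; apply: continuousD; [exact: cf|exact: cg].
have cM (f g : R -> R) : continuous f -> continuous g ->
    continuous (fun t => f t * g t).
  by move=> cf cg t; apply: continuousM; [exact: cf|exact: cg].
have cN (f : R -> R) : continuous f -> continuous (fun t => - f t).
  by move=> cf t; apply: continuousN; exact: cf.
have F1 : continuous (fun t : R => a + t * (b - a)) by apply: cD => //; apply: cM.
have F2 : continuous (fun t : R => s * ((t * (b - a)) * ((1 - t) * (b - a)))).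
  by apply: (cM) => //; apply: (cM); apply: (cM) => //; apply: cD => //; exact: cN.
by move=> t; exact: (cvg_pair (F1 t) (F2 t)).
Qed.

Lemma parabola_sign a b (s t : R) : a < b -> 0 < t < 1 -> s != 0 ->
  0 < s * (parabola a b s t).2.
Proof.
move=> ab /andP[t0 t1] s0; rewrite /= mulrA mulr_gt0 //.
  by rewrite -expr2 exprn_even_gt0.
by rewrite !mulr_gt0 ?subr_gt0.
Qed.

Lemma parabola_abscissa a b (s t : R) : a < b -> 0 < t < 1 ->
  a < (parabola a b s t).1 < b.
Proof.
move=> ab /andP[t0 t1]; rewrite /= ltrDl mulr_gt0 ?subr_gt0 //=.
by rewrite -ltrBrDl gtr_pMl ?subr_gt0.
Qed.

(** At an abscissa [x] inside the smaller interval, [(x - a) * (b - x)] exceeds [(x - c) * (d - x)].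
    Intervals with one common end must be allowed, as edges may share a vertex. *)
Lemma nested_parabolas_disjoint a b c d (s t u : R) : a <= c -> d <= b ->
  c < d -> (a < c) || (d < b) -> s != 0 -> 0 < t < 1 -> 0 < u < 1 ->
  parabola a b s t <> parabola c d s u.
Proof.
move=> ac db cd strict s0 t01 u01 [xE /(mulfI s0)].
set x := a + _ in xE.
have -> : t * (b - a) = x - a by rewrite /x; ring.
have -> : (1 - t) * (b - a) = b - x by rewrite /x; ring.
have -> : u * (d - c) = x - c by rewrite xE; ring.
have -> : (1 - u) * (d - c) = d - x by rewrite xE; ring.
have cx : 0 < x - c by rewrite xE addrAC subrr add0r mulr_gt0 ?subr_gt0; case/andP: u01.
have xd : 0 < d - x.
  have -> : d - x = (1 - u) * (d - c) by rewrite xE; ring.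
  by rewrite mulr_gt0 ?subr_gt0; case/andP: u01.
by case/orP: strict => H; nra.
Qed.
End Parabola.

Definition graph_of (T : finType) (E : rel T) : {set {set T}} :=
  [set e | [exists x, exists y, E x y && (e == [set x; y]%SET)]]%SET.

Lemma graph_of_esetP (T : finType) (E : rel T) : irreflexive E ->
  [forall e in graph_of E, (e \subset [set: T]%SET) && (#|e| == 2)].
Proof.
move=> Eirr; apply/forall_inP => e; rewrite finset.subsetT inE.
case/existsP=> x /existsP[y /andP[xy /eqP->]]; rewrite cards2.
by have [yx|] := eqVneq x y; first by rewrite yx Eirr in xy.
Qed.

Lemma book6_planar (R : realType) (T : finType) (E : rel T) (G : sgraph T) :
  book6 E -> eset G = graph_of E -> planar R G.
Proof.
move=> [Esym Eirr [pos [pg [pos_inj pg_sym nocross]]] _] GE.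
have ends e : exists xy : option (T * T), e \in eset G -> exists x y, [/\ xy = Some (x, y),
    e = [set x; y]%SET, E x y & (pos x < pos y)%N].
  have [eG|_] := boolP (e \in eset G); last by exists None.
  move: (eG); rewrite GE inE => /existsP[x /existsP[y /andP[xy /eqP->]]].
  have [lt|lt|/pos_inj eq] := ltngtP (pos x) (pos y).
  - by exists (Some (x, y)) => _; exists x, y.
  - by exists (Some (y, x)) => _; exists y, x; rewrite finset.setUC Esym.
  - by rewrite eq Eirr in xy.
have [xy xyP] := choice ends.
pose P (v : T) : R := (pos v)%:R.
pose sgn x y : R := if pg x y then 1 else -1.
pose gamma e t := if xy e is Some (x, y) then parabola (P x) (P y) (sgn x y) t else (0, 0).
have sgn0 x y : sgn x y != 0.
  by rewrite /sgn; case: (pg x y); rewrite ?oppr_eq0 oner_eq0.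
have P_lt x y : (P x < P y) = (pos x < pos y)%N by rewrite ltr_nat.
exists (fun v => (P v, 0)), gamma; split.
- by move=> u v _ _ [/eqP]; rewrite eqr_nat => /eqP /pos_inj.
- move=> e /xyP[x [y [xyE eE Exy xlty]]]; rewrite /gamma xyE; split.
  + by apply: continuous_subspaceT; exact: parabola_continuous.
  + move=> t u _ _ [/addrI e01 _]; apply: (mulIf _ e01).
    by rewrite subr_eq0 eq_sym lt_eqF // P_lt.
  + have -> : parabola (P x) (P y) (sgn x y) 0 = (P x, 0).
      by rewrite /parabola !mul0r mulr0 addr0.
    have -> : parabola (P x) (P y) (sgn x y) 1 = (P y, 0).
      by rewrite /parabola subrr mul0r !mulr0 mul1r addrC subrK.
    rewrite eE; apply/seteqP; split => z /=.
      by case=> ->; [exists x|exists y]; rewrite //= !inE eqxx ?orbT.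
    by case=> v; rewrite /= !inE => /orP[/eqP->|/eqP->] <-; [left|right].
- move=> e v t /xyP[x [y [xyE eE Exy xlty]]] _; rewrite in_itv /= /gamma xyE => t01 H.
  have := parabola_sign (_ : P x < P y) t01 (sgn0 x y).
  by rewrite H /= mulr0 ltxx P_lt => /(_ xlty).
- move=> e f t u /xyP[x [y [xyE eE Exy xy_lt]]] /xyP[z [w [zwE fE Ezw zw_lt]]] ef.
  rewrite !in_itv /= /gamma xyE zwE => t01 u01.
  have [pgE|pgN] := eqVneq (pg x y) (pg z w); last first.
    move=> H; have := parabola_sign (_ : P x < P y) t01 (sgn0 x y).
    have := parabola_sign (_ : P z < P w) u01 (sgn0 z w).
    rewrite H !P_lt => /(_ zw_lt) + /(_ xy_lt).
    by move: pgN; rewrite /sgn; case: (pg x y); case: (pg z w) => // _; lra.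
  have sE : sgn z w = sgn x y by rewrite /sgn pgE.
  rewrite sE => H.
  have := parabola_abscissa (sgn x y) (_ : P x < P y) t01.
  have := parabola_abscissa (sgn x y) (_ : P z < P w) u01.
  rewrite -H !P_lt => /(_ zw_lt)/andP[zX Xw] /(_ xy_lt)/andP[xX Xy].
  (* Both arcs pass over the same abscissa, so the intervals overlap; as they do not interleave, one
     contains the other. *)
  have zy : (pos z < pos y)%N by rewrite -P_lt; exact: lt_trans Xy.
  have xw : (pos x < pos w)%N by rewrite -P_lt; exact: lt_trans Xw.
  have nested x1 y1 z1 w1 t1 u1 : (pos x1 <= pos z1)%N -> (pos w1 <= pos y1)%N ->
      (pos z1 < pos w1)%N -> (pos x1 < pos z1)%N || (pos w1 < pos y1)%N ->
      0 < t1 < 1 -> 0 < u1 < 1 ->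
      parabola (P x1) (P y1) (sgn x y) t1 <> parabola (P z1) (P w1) (sgn x y) u1.
    by move=> *; apply: nested_parabolas_disjoint; rewrite ?P_lt ?ler_nat.
  have [xz|zx|xz] := ltngtP (pos x) (pos z).
  + have [yw|wy] := ltnP (pos y) (pos w); first exact: nocross Exy Ezw pgE xz zy yw.
    by apply: nested H; rewrite ?xz // ltnW.
  + have [wy|yw] := ltnP (pos w) (pos y).
      exact: nocross Ezw Exy (esym pgE) zx xw wy.
    by apply: nested (esym H); rewrite ?zx // ltnW.
  + have [yw|wy|yw] := ltngtP (pos y) (pos w).
    * by apply: nested (esym H); rewrite ?xz ?yw ?orbT // ltnW.
    * by apply: nested H; rewrite ?xz ?wy ?orbT // ltnW.
    * by case/eqP: ef; rewrite eE fE (pos_inj _ _ xz) (pos_inj _ _ yw).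
Qed.

Lemma graph_ofP (T : finType) (E : rel T) x y : symmetric E -> irreflexive E ->
  ([set x; y]%SET \in graph_of E) = E x y.
Proof.
move=> Esym Eirr; apply/idP/idP => [|xy]; last first.
  by rewrite inE; apply/existsP; exists x; apply/existsP; exists y; rewrite xy eqxx.
rewrite inE => /existsP[u /existsP[v /andP[uv /eqP/setP xyuv]]].
have := xyuv x; have := xyuv y; have := xyuv u; have := xyuv v.
rewrite !inE !eqxx ?orbT /= => vxy uxy yuv xuv.
have uNv : u != v by apply: contraTneq uv => ->; rewrite Eirr.
case/esym/orP: xuv => /eqP xE; case/esym/orP: yuv => /eqP yE.
- by move: vxy; rewrite xE yE orbb eq_sym (negPf uNv).
- by rewrite xE yE.
- by rewrite xE yE Esym.
- by move: uxy; rewrite xE yE orbb (negPf uNv).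
Qed.

Lemma book6_girth (T : finType) (E : rel T) (G : sgraph T) :
  book6 E -> eset G = graph_of E -> girth_geq 6 G.
Proof.
move=> [Esym Eirr _ E6] GE; apply/girth_geqP => k [c [<- c3 /andP[cc Uc]]].
apply: E6 => //; rewrite /ucycle Uc andbT; apply: sub_cycle cc => x y.
by rewrite /adj GE graph_ofP.
Qed.

Definition book6_cover (T : eqType) (k : nat) : Prop :=
  exists E : 'I_k -> rel T, (forall i, book6 (E i)) /\
    forall x y, x != y -> exists i, E i x y.

Lemma book6_cover_complete (R : realType) (n k : nat) : (0 < k)%N ->
  book6_cover 'I_n k -> girth_cover R 6 (complete_graph n) k.
Proof.
move=> k0 [E [gE Ecov]].
have Eirr i : irreflexive (E i) by have [] := gE i.
exists (fun i => SGraph (graph_of_esetP (Eirr i))); split=> [i|].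
  split; [|exact: book6_planar (gE i) _|exact: book6_girth (gE i) _].
  rewrite /subgraph /= finset.subsetT; apply/fintype.subsetP => e eE.
  by have /forall_inP/(_ e eE)/andP[_ e2] := graph_of_esetP (Eirr i); rewrite inE.
split=> /=.
  apply/setP => x; rewrite inE; apply/esym/bigcupP.
  by exists (Ordinal k0); rewrite ?inE.
apply/setP => e; rewrite inE; apply/idP/bigcupP => [/cards2P[x [y [xy ->]]]|[i _ eE]].
  have [i Exy] := Ecov x y xy; exists i => //.
  by have [Esym _ _ _] := gE i; rewrite graph_ofP.
by have /forall_inP/(_ e eE)/andP[_ e2] := graph_of_esetP (Eirr i).
Qed.

Lemma book6_preim (T T' : eqType) (f : T -> T') (E : rel T') : injective f ->
  book6 E -> book6 (fun x y => E (f x) (f y)).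
Proof.
move=> f_inj [Esym Eirr [pos [pg [pos_inj pg_sym nocross]]] E6]; split.
- by move=> x y; exact: Esym.
- by move=> x; exact: Eirr.
- exists (pos \o f), (fun x y => pg (f x) (f y)); split=> [|x y|x y u v]; last exact: nocross.
    exact: inj_comp.
  exact: pg_sym.
- move=> c c3 /andP[cc Uc]; rewrite -(size_map f); apply: E6; rewrite ?size_map //.
  by rewrite /ucycle map_inj_uniq // Uc andbT cycle_map.
Qed.

Lemma book6_sub (T : eqType) (E E' : rel T) : symmetric E' -> subrel E' E ->
  book6 E -> book6 E'.
Proof.
move=> E'sym sub [Esym Eirr [pos [pg [pos_inj pg_sym nocross]]] E6]; split=> //.
- by move=> x; apply/negP => /sub; rewrite Eirr.
- exists pos, pg; split=> // x y u v /sub xy /sub uv; exact: nocross.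
- move=> c c3 /andP[cc Uc]; apply: E6 => //.
  by rewrite /ucycle Uc andbT; exact: sub_cycle cc.
Qed.

Lemma book6_cover_preim (T T' : eqType) (f : T -> T') (k : nat) : injective f ->
  book6_cover T' k -> book6_cover T k.
Proof.
move=> f_inj [E [gE Ecov]]; exists (fun i x y => E i (f x) (f y)); split=> [i|x y xy].
  exact: book6_preim.
by apply: Ecov; rewrite inj_eq.
Qed.

(** * Plans with repeated paths *)

Local Open Scope nat_scope.

Section Layout.
Variables (L : seq (nat * nat * bool)) (blk dec : seq nat).

(* Node [a] of the plan [L] stands for the vertices [(a, j)], for all [j] if [a]
   is in [blk] and for [j = 0] otherwise; the nodes are numbered in the order
   of the book embedding, and a node of [dec] lists its vertices backwards. *)
Definition plan_edge (x y : nat * nat) : bool :=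
  [&& has (fun b => ((x.1, y.1, b) \in L) || ((y.1, x.1, b) \in L)) [:: true; false],
   (x.1 \in blk) || (x.2 == 0), (y.1 \in blk) || (y.2 == 0) &
   (x.1 \in blk) && (y.1 \in blk) ==> (x.2 == y.2)].

Definition plan_page (x y : nat * nat) : bool :=
  ((x.1, y.1, true) \in L) || ((y.1, x.1, true) \in L).

Definition plan_lt (x y : nat * nat) : bool :=
  (x.1 < y.1) || (x.1 == y.1) && (if x.1 \in dec then y.2 < x.2 else x.2 < y.2).

(** Five copies are enough for testing: a crossing involves four vertices, a cycle shorter than 6 at
    most five. *)
Definition plan_vertices (m : nat) : seq (nat * nat) :=
  [seq (a, j) | a <- iota 0 m, j <- if a \in blk then iota 0 5 else [:: 0]].

Definition plan_edges (m : nat) : seq ((nat * nat) * (nat * nat)) :=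
  let V := plan_vertices m in
  [seq xy <- [seq (x, y) | x <- V, y <- V] | plan_edge xy.1 xy.2].

Definition plan_nocross (m : nat) : bool :=
  let D := plan_edges m in
  all (fun e => all (fun f => ~~ [&& plan_page e.1 e.2 == plan_page f.1 f.2,
    plan_lt e.1 f.1, plan_lt f.1 e.2 & plan_lt e.2 f.2]) D) D.

Definition plan_girth (m : nat) : bool :=
  let V := plan_vertices m in
  let next p x := [seq y <- V | plan_edge x y && (y \notin p)] in
  all (fun x1 => all (fun x2 => all (fun x3 => ~~ plan_edge x3 x1 &&
    all (fun x4 => ~~ plan_edge x4 x1 &&
      all (fun x5 => ~~ plan_edge x5 x1) (next [:: x1; x2; x3; x4] x4))
    (next [:: x1; x2; x3] x3)) (next [:: x1; x2] x2)) (next [:: x1] x1)) V.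

Definition plan_ok (m : nat) : bool :=
  [&& all (fun e => e.1.1 != e.1.2) L, plan_nocross m & plan_girth m].

Lemma plan_edge_sym : symmetric plan_edge.
Proof.
move=> x y; rewrite /plan_edge /= [y.2 == x.2]eq_sym.
by do ![case: (_ \in _) => //=]; rewrite ?andbT ?orbT ?orbF // andbC.
Qed.

Lemma plan_page_sym : symmetric plan_page.
Proof. by move=> x y; rewrite /plan_page orbC. Qed.

Section Compression.
Variable s : seq nat.

(* Vertices are compared and joined by their indices only through equality and
   order, so five of them can be renamed to have indices below 5. *)
Definition rank_in (j : nat) : nat := count (fun i => i < j) (undup s).

Lemma rank_in_lt j k : j \in s -> (rank_in j < rank_in k) = (j < k).
Proof.
move=> js; apply/idP/idP => [|jk].
  apply: contraLR; rewrite -!leqNgt => kj; apply: sub_count => i ik.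
  exact: leq_trans ik kj.
rewrite /rank_in; have : j \in undup s by rewrite mem_undup.
elim: (undup s) => //= i t IHt; rewrite inE => /orP[/eqP <-|/IHt lt].
  rewrite ltnn jk add0n add1n ltnS; apply: sub_count => l /=.
  by move=> lj; exact: ltn_trans jk.
rewrite -addnS leq_add //; case: (ltnP i j) => //= ij.
by rewrite (ltn_trans ij jk).
Qed.

Lemma rank_in_inj j k : j \in s -> k \in s -> rank_in j = rank_in k -> j = k.
Proof.
move=> js ks eq; have := rank_in_lt k js; have := rank_in_lt j ks.
by rewrite eq ltnn; case: ltngtP.
Qed.

(** A node outside [blk] has only the index 0, which the renaming therefore has to fix. *)
Lemma rank_in0 : rank_in 0 = 0.
Proof. by rewrite /rank_in; elim: (undup s). Qed.

Lemma rank_in_ltn j : j \in s -> rank_in j < size s.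
Proof.
move=> js; apply: leq_trans (size_undup s).
rewrite -(count_predC (fun i => i < j)) -addn1 leq_add2l -has_count.
by apply/hasP; exists j; rewrite ?mem_undup //= ltnn.
Qed.

Definition compress (x : nat * nat) : nat * nat := (x.1, rank_in x.2).

Lemma compress_edge x y : plan_edge x y -> plan_edge (compress x) (compress y).
Proof.
case/and4P=> xyL xb yb xy2; apply/and4P; split=> //=.
- by case/orP: xb => [->//|/eqP->]; rewrite rank_in0 orbT.
- by case/orP: yb => [->//|/eqP->]; rewrite rank_in0 orbT.
- by apply/implyP => xyb; rewrite xyb /= in xy2; rewrite (eqP xy2).
Qed.

Lemma compress_page x y : plan_page (compress x) (compress y) = plan_page x y.
Proof. by []. Qed.

Lemma compress_lt x y : x.2 \in s -> y.2 \in s ->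
  plan_lt (compress x) (compress y) = plan_lt x y.
Proof. by move=> xs ys; rewrite /plan_lt /= !rank_in_lt. Qed.

Lemma compress_inj x y : x.2 \in s -> y.2 \in s -> compress x = compress y -> x = y.
Proof.
by case: x y => a j [b k] /= js ks [-> /(rank_in_inj js ks) ->].
Qed.

Lemma compress_in m x y : size s <= 5 -> x.1 < m -> x.2 \in s -> plan_edge x y ->
  compress x \in plan_vertices m.
Proof.
move=> s5 xm xs /and4P[_ xb _ _]; apply/allpairsPdep.
exists x.1, (rank_in x.2); split=> //; first by rewrite mem_iota.
case/orP: xb => [->|/eqP->]; first by rewrite mem_iota (leq_trans (rank_in_ltn xs)).
by rewrite rank_in0; case: ifP.
Qed.
End Compression.

Variables m M : nat.
Hypothesis ok : plan_ok m.

Let E : rel ('I_m * 'I_M) := fun x y => plan_edge (val x.1, val x.2) (val y.1, val y.2).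
Let code (x : 'I_m * 'I_M) : nat * nat := (val x.1, val x.2).

Lemma plan_book6 : book6 E.
Proof.
have Esym : symmetric E by move=> x y; exact: plan_edge_sym.
have /and3P[Lirr nocr gir] := ok.
have Eirr : irreflexive E.
  move=> x; apply/negP => /and4P[/hasP[b _ /=]].
  by rewrite orbb => /(allP Lirr) /=; rewrite eqxx.
split=> //.
  pose pos (x : 'I_m * 'I_M) := val x.1 * M + (if val x.1 \in dec then M.-1 - x.2 else x.2).
  have pos_lt x y : (pos x < pos y) = plan_lt (code x) (code y).
    case: x y => a j [b k]; rewrite /pos /plan_lt /=.
    have jM := ltn_ord j; have kM := ltn_ord k.
    set f := (if val a \in dec then _ else _); set g := (if val b \in dec then _ else _).
    have [fM gM] : f < M /\ g < M by rewrite /f /g; split; case: ifP => _; lia.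
    have [ab|ba|/val_inj ab] := ltngtP (val a) (val b) => /=.
    - apply/idP; apply: leq_trans (leq_addr g _).
      by apply: leq_trans (leq_mul ab (leqnn M)); rewrite mulSn addnC ltn_add2r.
    - apply/negbTE; rewrite -leqNgt; apply: leq_trans (leq_addr f _).
      by apply: leq_trans (leq_mul ba (leqnn M)); rewrite mulSn addnC leq_add2r ltnW.
    - by rewrite ab ltn_add2l /f /g ab; case: ifP => _; lia.
  exists pos, (fun x y => plan_page (code x) (code y)); split.
  - move=> x y xy; have := pos_lt x y; have := pos_lt y x; rewrite xy ltnn.
    case: x y xy => a j [b k] xy; rewrite /plan_lt /=.
    have [//|//|/val_inj ab] := ltngtP (val a) (val b).
    rewrite ab /=; case: ifP => _ kj jk; congr (_, _); apply/val_inj => /=; lia.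
  - by move=> x y; exact: plan_page_sym.
  - move=> x y u v xy uv pg; rewrite !pos_lt => xu uy yv.
    pose s := [:: val x.2; val y.2; val u.2; val v.2].
    have in_s z w : E z w -> val z.2 \in s -> compress s (code z) \in plan_vertices m.
      by move=> zw zs; apply: (@compress_in s m (code z) (code w)) => //=.
    have edge_in z w : E z w -> val z.2 \in s -> val w.2 \in s ->
        (compress s (code z), compress s (code w)) \in plan_edges m.
      move=> zw zs ws; rewrite mem_filter /= compress_edge //=.
      by apply/allpairsP; exists (compress s (code z), compress s (code w)); rewrite /= (in_s z w) // (in_s w z) // Esym.
    have xs : val x.2 \in s by rewrite !inE eqxx.
    have ys : val y.2 \in s by rewrite !inE eqxx orbT.
    have us : val u.2 \in s by rewrite !inE eqxx !orbT.
    have vs : val v.2 \in s by rewrite !inE eqxx !orbT.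
    have /allP/(_ _ (edge_in u v uv us vs)) := allP nocr _ (edge_in x y xy xs ys).
    by rewrite /= !compress_page !compress_lt // xu uy yv pg eqxx.
move=> c c3 /andP[cE Uc]; rewrite ltnNge; apply/negP => c5.
pose s := [seq val x.2 | x <- c].
have in_s x : x \in c -> val x.2 \in s by move=> xc; apply/mapP; exists x.
pose f x := compress s (code x).
have f_inj : {in c &, injective f}.
  move=> x y /in_s xs /in_s ys fxy.
  have := @compress_inj s (code x) (code y) xs ys fxy.
  by case: x y {xs ys fxy} => a b [a' b'] [/val_inj -> /val_inj ->].
have fE x y : E x y -> plan_edge (f x) (f y) by exact: compress_edge.
have fV x : x \in c -> f x \in plan_vertices m.
  move=> xc; apply: (@compress_in s m _ (code (next c x))) => //=.
  - by rewrite /s size_map.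
  - exact: in_s.
  - exact: (next_cycle cE xc).
have Ufc : uniq (map f c) by rewrite map_inj_in_uniq.
have cfE : cycle plan_edge (map f c) by rewrite cycle_map; exact: sub_cycle cE.
have V_c x : x \in map f c -> x \in plan_vertices m by case/mapP => y /fV yV ->.
move: c3 c5; rewrite -(size_map f).
move: (map f c) Ufc cfE V_c => {fV fE f_inj f in_s s cE Uc c} c Uc cE V_c c3 c5.
have V_E x y p : plan_edge x y -> y \in c -> y \notin p ->
    y \in [seq y <- plan_vertices m | plan_edge x y && (y \notin p)].
  by move=> xy yc yp; rewrite mem_filter xy yp V_c.
case: c Uc cE V_c V_E c3 c5 => [|x1 [|x2 [|x3 c]]] // Uc cE V_c V_E _ c5.
move/and3P: ok => [_ _ /allP/(_ x1)]; rewrite V_c ?inE ?eqxx // => /(_ isT).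
move: cE; rewrite /= => /and3P[x12 x23 pc].
move/allP/(_ x2); rewrite V_E ?inE ?eqxx ?orbT //; last first.
  by move: Uc; rewrite /= !inE !negb_or eq_sym; case/andP=> /and3P[].
move=> /(_ isT) /allP/(_ x3); rewrite V_E ?inE ?eqxx ?orbT //; last first.
  move: Uc; rewrite /= !inE !negb_or => /and3P[/and3P[_ x13 _] /andP[x23' _] _].
  by rewrite eq_sym x13 eq_sym x23'.
move=> /(_ isT) /andP[n31].
case: c Uc V_c V_E pc c5 => [|x4 c] Uc V_c V_E pc c5 /=.
  by move: pc => /=; rewrite (negPf n31).
case/andP: pc => x34 pc /allP/(_ x4); rewrite V_E ?inE ?eqxx ?orbT //; last first.
  move: Uc; rewrite /= !inE !negb_or => /and4P[/and4P[_ _ x14 _] /and3P[_ x24 _] /andP[x34' _] _].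
  by rewrite eq_sym x14 eq_sym x24 eq_sym x34'.
move=> /(_ isT) /andP[n41].
case: c Uc V_c V_E pc c5 => [|x5 c] Uc V_c V_E pc c5 /=.
  by move: pc => /=; rewrite (negPf n41).
case: c Uc V_c V_E pc c5 => [|//] Uc V_c V_E /= /and3P[x45 x51 _] _.
move=> /allP/(_ x5); rewrite V_E ?inE ?eqxx ?orbT //; last first.
  move: Uc; rewrite /= !inE !negb_or => /and5P[/and4P[_ _ _ x15] /and3P[_ _ x25] /andP[_ x35] x45' _].
  by rewrite eq_sym x15 eq_sym x25 eq_sym x35 eq_sym x45'.
by move=> /(_ isT); rewrite x51.
Qed.
End Layout.

Lemma book6_image (T T' : finType) (f : T -> T') (E : rel T) : injective f ->
  book6 E -> book6 (fun u v => [exists x, exists y, [&& E x y, u == f x & v == f y]]).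
Proof.
move=> f_inj [Esym Eirr [pos [pg [pos_inj pg_sym nocross]]] E6].
set E' := (X in book6 X).
have E'P u v : reflect (exists x y, [/\ E x y, u = f x & v = f y]) (E' u v).
  apply: (iffP existsP) => -[x].
    by case/existsP=> y /and3P[xy /eqP-> /eqP->]; exists x, y.
  by case=> y [xy -> ->]; exists x; apply/existsP; exists y; rewrite xy !eqxx.
pose g v := [pick x | f x == v].
have gK x : g (f x) = Some x.
  by rewrite /g; case: pickP => [y /eqP/f_inj->|/(_ x)]; rewrite ?eqxx.
split.
- by move=> u v; apply/E'P/E'P => -[x [y [xy -> ->]]]; exists y, x; rewrite Esym.
- by move=> u; apply/E'P => -[x [y [xy -> /f_inj yx]]]; rewrite yx Eirr in xy.
(* Vertices outside the image are isolated and are placed after all others, from [K] on. *)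
- pose K := (\max_x pos x).+1.
  pose pos' v := if g v is Some x then pos x else K + enum_rank v.
  pose pg' u v := if (g u, g v) is (Some x, Some y) then pg x y else true.
  exists pos', pg'; split.
  + have pos_lt v x : g v = Some x -> (pos' v < K) * (f x = v).
      rewrite /pos' => gv; rewrite gv ltnS leq_bigmax.
      by move: gv; rewrite /g; case: pickP => // y /eqP yv [<-].
    move=> u v; have := pos_lt u; have := pos_lt v; rewrite /pos'.
    case: (g u) => [x|]; case: (g v) => [y|] Hv Hu.
    * by move/pos_inj => xy; rewrite -(Hu x erefl).2 -(Hv y erefl).2 xy.
    * by have := (Hu x erefl).1; lia.
    * by have := (Hv y erefl).1; lia.
    * by move/addnI/val_inj/enum_rank_inj.
  + by move=> u v; rewrite /pg'; case: (g u) => [x|]; case: (g v) => [y|].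
  + move=> u v w z /E'P[x [y [xy -> ->]]] /E'P[x' [y' [xy' -> ->]]].
    by rewrite /pg' /pos' !gK; exact: nocross.
- move=> c c3 /andP[cc Uc].
  have [x0 x0c] : exists x, f x \in c.
    case: c c3 cc {Uc} => [|u [|v c]] //= _ /andP[/E'P[x [y [_ -> _]]] _].
    by exists x; rewrite inE eqxx.
  pose h v := odflt x0 (g v).
  have E'h u v : E' u v -> E (h u) (h v) /\ f (h u) = u.
    by case/E'P=> x [y [xy -> ->]]; rewrite /h !gK.
  rewrite -(size_map h); apply: E6; rewrite ?size_map //.
  rewrite /ucycle map_inj_in_uniq ?Uc ?andbT.
    by rewrite cycle_map; apply: sub_cycle cc => u v /E'h[].
  move=> u v /(next_cycle cc)/E'h[_ uE] /(next_cycle cc)/E'h[_ vE] uv.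
  by rewrite -uE -vE uv.
Qed.

Lemma ucycle_two_neighbours (T : eqType) (E : rel T) c x :
  2 < size c -> ucycle E c -> x \in c ->
  exists y z, [/\ y != z, y \in c, z \in c, E x y & E z x].
Proof.
move=> c3 /andP[cc Uc] xc; have [i c' rc] := rot_to xc.
have in_c y : y \in x :: c' -> y \in c by rewrite -rc mem_rot.
move: c3 Uc cc; rewrite -(size_rot i) -(rot_uniq i) -(rot_cycle i) rc.
case: c' {rc} in_c => [|y [|z c']] // in_c _ /= /andP[_ /andP[yc _]].
rewrite rcons_path => /andP[xy /and3P[_ _ lx]].
exists y, (last z c'); split=> //.
- by apply: contraNneq yc => ->; exact: mem_last.
- by apply: in_c; rewrite !inE eqxx orbT.
- by apply: in_c; have := mem_last z c'; rewrite !inE => ->; rewrite !orbT.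
Qed.

(** The edge is added only if [x] is isolated and different from [v], so that pendant edges can be
    requested uniformly for all shifts. *)
Definition add_pendant (T : finType) (E : rel T) (x v : T) : rel T := fun a b =>
  E a b || [&& x != v, [forall y, ~~ E x y] &
            (a == x) && (b == v) || (a == v) && (b == x)].

(** The isolated vertex [x] is moved right behind [v], where doubling the old positions makes room.
    An edge between neighbours on the line crosses nothing, and a vertex of degree 1 is on no
    cycle. *)
Lemma book6_add_pendant (T : finType) (E : rel T) (x v : T) :
  book6 E -> book6 (add_pendant E x v).
Proof.
move=> Ebook6; rewrite /add_pendant.
have Esame : book6 (fun a b => E a b || false).
  have [Esym _ _ _] := Ebook6.
  by apply: book6_sub Ebook6 => a b; rewrite !orbF.
have [xv|] := boolP (x != v); last first.
  by move=> _; exact: Esame.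
have [/forallP x0|] := boolP [forall y, ~~ E x y]; last first.
  by move=> _; exact: Esame.
case: Ebook6 => Esym Eirr [pos [pg [pos_inj pg_sym nocross]]] E6.
have x0' y : E y x = false by rewrite Esym; exact/negbTE.
split=> /=.
- by move=> a b; rewrite Esym [X in _ || X]orbC; congr (_ || (_ || _)); rewrite andbC.
- move=> a; rewrite Eirr /=; have [->|_] := eqVneq a x; first by rewrite (negPf xv).
  by rewrite andbF.
- pose pos' w := if w == x then (pos v).*2.+1 else (pos w).*2.
  exists pos', pg; split=> //.
    move=> a b; rewrite /pos'; case: (eqVneq a x) => [->|_]; case: (eqVneq b x) => [->|_] //.
    + by lia.
    + by lia.
    + by move/double_inj/pos_inj.
  have posE a b : E a b -> pos' a = (pos a).*2 /\ pos' b = (pos b).*2.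
    move=> ab; rewrite /pos'.
    have -> : (a == x) = false by apply: contraTF ab => /eqP->; exact: x0.
    by have -> : (b == x) = false by apply: contraTF ab => /eqP->; rewrite x0'.
  have pos'x : pos' x = (pos v).*2.+1 by rewrite /pos' eqxx.
  have pos'v : pos' v = (pos v).*2 by rewrite /pos' eq_sym (negPf xv).
  move=> a b c d /= /orP[ab|ab] /orP[cd|cd] pgE ac cb bd.
  + have [aE bE] := posE _ _ ab; have [cE dE] := posE _ _ cd.
    by apply: nocross ab cd pgE _ _ _; lia.
  + have [aE bE] := posE _ _ ab.
    by case/orP: cd ac cb bd => /andP[/eqP-> /eqP->]; lia.
  + by case/orP: ab ac cb bd => /andP[/eqP-> /eqP->]; lia.
  + by case/orP: ab ac cb bd => /andP[/eqP-> /eqP->]; lia.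
move=> c c3 Uc; have [cc uc] := andP Uc.
have [xc|xc] := boolP (x \in c).
  have [y [z [yz _ _ xy zx]]] := ucycle_two_neighbours c3 Uc xc.
  have yv : y = v.
    by move: xy; rewrite (negPf (x0 _)) eqxx (negPf xv) /= orbF => /eqP.
  have zv : z = v.
    by move: zx; rewrite x0' eqxx (negPf xv) andbF andbT /= => /eqP.
  by rewrite yv zv eqxx in yz.
apply: E6 => //; rewrite /ucycle uc andbT.
apply: sub_in_cycle cc => [a b|]; last first.
  by apply/allP => y yc; apply: (_ : y \in predC1 x); rewrite inE; apply: contraNneq xc => <-.
rewrite !inE => /negPf ax /negPf bx.
by rewrite /= ax bx andbF !orbF.
Qed.

Lemma sub_add_pendant (T : finType) (E : rel T) (x v : T) : subrel E (add_pendant E x v).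
Proof. by move=> a b ab; rewrite /add_pendant ab. Qed.

Lemma add_pendant_edge (T : finType) (E : rel T) (x v : T) : x != v ->
  (forall y, ~~ E x y) -> add_pendant E x v x v.
Proof.
by move=> xv x0; rewrite /add_pendant xv !eqxx /= andbT; apply/orP; right; apply/forallP.
Qed.

Lemma add_pendant_isolated (T : finType) (E : rel T) (x v w : T) : w != x -> w != v ->
  (forall y, ~~ E w y) -> forall y, ~~ add_pendant E x v w y.
Proof.
by move=> wx wv w0 y; rewrite /add_pendant (negPf wx) (negPf wv) !andbF orbF.
Qed.

(* The vertex [F a j] is the [j]-th of the [cnt a] copies of node [a]. *)
Definition plan_rel (T : finType) (L : seq (nat * nat * bool)) (blk : seq nat)
    (m : nat) (cnt : nat -> nat) (F : nat -> nat -> T) : rel T := fun u v =>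
  `[< exists x y, [/\ [&& x.1 < m, y.1 < m, x.2 < cnt x.1 & y.2 < cnt y.1],
     plan_edge L blk x y, u = F x.1 x.2 & v = F y.1 y.2] >].

Lemma plan_rel_book6 (T : finType) (L : seq (nat * nat * bool)) (blk dec : seq nat)
    (m : nat) (cnt : nat -> nat) (F : nat -> nat -> T) :
  plan_ok L blk dec m ->
  (forall a j b k, a < m -> b < m -> j < cnt a -> k < cnt b -> F a j = F b k ->
     a = b /\ j = k) ->
  book6 (plan_rel L blk m cnt F).
Proof.
move=> ok F_inj; pose M := (\max_(a < m) cnt a).
have cntM a : a < m -> cnt a <= M by move=> am; exact: (leq_bigmax (Ordinal am)).
pose U : finType := {x : 'I_m * 'I_M | x.2 < cnt x.1}.
have Ubook6 := book6_preim (val_inj : injective (val : U -> _)) (plan_book6 M ok).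
pose f (x : U) := F (val x).1 (val x).2.
have f_inj : injective f.
  move=> [[a j] /= ja] [[b k] /= kb] /(F_inj _ _ _ _ (ltn_ord a) (ltn_ord b) ja kb) [ab jk].
  by apply/val_inj; congr (_, _); exact/val_inj.
have lift x : x.1 < m -> x.2 < cnt x.1 -> exists z : U, x = (nat_of_ord (val z).1, nat_of_ord (val z).2).
  case: x => a j /= am ja; have jM : j < M := leq_trans ja (cntM a am).
  by exists (exist _ (Ordinal am, Ordinal jM) ja).
apply: book6_sub (book6_image f_inj Ubook6).
  by move=> u v; apply/asboolP/asboolP => -[x [y [xy E -> ->]]]; exists y, x;
    rewrite plan_edge_sym; split=> //; case/and4P: xy => *; apply/and4P.
move=> u v /asboolP[x [y [/and4P[xm ym xc yc] E -> ->]]].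
have [z zE] := lift x xm xc; have [w wE] := lift y ym yc.
apply/existsP; exists z; apply/existsP; exists w.
by rewrite zE wE /f /= !eqxx !andbT; move: E; rewrite zE wE.
Qed.

Lemma plan_relI (T : finType) L blk m cnt (F : nat -> nat -> T) a j b k :
  [&& a < m, b < m, j < cnt a & k < cnt b] -> plan_edge L blk (a, j) (b, k) ->
  plan_rel L blk m cnt F (F a j) (F b k).
Proof. by move=> H E; apply/asboolP; exists (a, j), (b, k). Qed.

Lemma plan_rel_isolated (T : finType) L blk m cnt (F : nat -> nat -> T) w :
  (forall a j, a < m -> j < cnt a -> w != F a j) ->
  forall y, ~~ plan_rel L blk m cnt F w y.
Proof.
move=> wF y; apply/negP => /asboolP[u [v [/and4P[um _ uc _] _ wE _]]].
by have := wF _ _ um uc; rewrite wE eqxx.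
Qed.

(** * The cyclic construction *)

(* Three bundles of paths of length 3 between pairs of hubs, arranged in a ring.
   The nodes are, in this order,
   X4 X5 X0 Z5 Za Z0 Zb Z4 Y0 Ya Yb Y5 Xa Xb Y4 X3 Y3 BR Z3 CR AR,
   where X0 and X3 are the hubs of the first bundle, X0 X5 X4 X3 one of its
   paths, and X0 Xa Xb X3 its other paths. *)
Definition ring_plan : seq (nat * nat * bool) :=
  [:: (2, 1, false); (1, 0, false); (0, 15, false); (2, 12, false);
      (12, 13, true); (13, 15, false); (2, 11, false); (15, 14, false);
      (8, 11, false); (11, 14, true); (14, 16, true); (8, 9, true);
      (9, 10, false); (10, 16, true); (8, 3, false); (16, 7, true);
      (5, 3, true); (3, 7, false); (7, 18, true); (5, 4, true);
      (4, 6, false); (6, 18, true); (5, 1, true); (18, 0, false);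
      (16, 17, false); (18, 19, false); (19, 20, false)].
Definition ring_blk : seq nat := [:: 4; 6; 9; 10; 12; 13].
(** The middle edges of a bundle join equal indices of two blocks; listing one of the two blocks
    backwards nests these edges. *)
Definition ring_dec : seq nat := [:: 6; 10; 13].

Lemma ring_plan_ok : plan_ok ring_plan ring_blk ring_dec 21.
Proof. by vm_compute. Qed.

(* Bundles of paths of length 3 between any two of three hubs x, y, z, with the
   additional paths x a b y and x a c z; the order is
   2a 2b 1b 1a 3b 3a z a x b c y. *)
Definition triangle_plan : seq (nat * nat * bool) :=
  [:: (8, 7, false); (7, 9, true); (9, 11, false); (7, 10, true);
      (10, 6, true); (8, 3, false); (3, 2, true); (2, 11, false);
      (11, 0, true); (0, 1, false); (1, 6, true); (6, 5, false);
      (5, 4, true); (4, 8, false)].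
Definition triangle_blk : seq nat := [:: 0; 1; 2; 3; 4; 5].
Definition triangle_dec : seq nat := [:: 1; 2; 4].

Lemma triangle_plan_ok : plan_ok triangle_plan triangle_blk triangle_dec 12.
Proof. by vm_compute. Qed.

Section Family.
Variable q : nat.
Hypothesis q2 : 1 < q.
Let N := q.*2.+1.

(* Classes 0, 1, 2 are the three copies A, B, C of the integers modulo [N]; the
   vertices 0 of classes 3, 4, 5 are three additional vertices x, y, z. *)
Definition vtx (c k : nat) : 'I_6 * 'I_N := (inord c, inord (k %% N)).

Lemma vtx_inj c c' k k' : c < 6 -> c' < 6 -> vtx c k = vtx c' k' ->
  c = c' /\ k = k' %[mod N].
Proof.
move=> c6 c6' [/(congr1 val) + /(congr1 val)].
by rewrite /= !inordK ?ltn_mod.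
Qed.

Lemma vtx_mod c k k' : k = k' %[mod N] -> vtx c k = vtx c k'.
Proof. by rewrite /vtx => ->. Qed.

(** The bundles are B_0 A_j A_(-j) C_q for [0 < j < q] and its images under rotating A, B, C. A copy
    with index [q - 2] in a block stands for one of x, y, z. *)
Definition ring_lab (a j : nat) : nat * nat :=
  match a with
  | 0 => (0, q.*2) | 1 => (0, 1) | 2 => (1, 0) | 3 => (2, 1)
  | 4 => if j < q - 2 then (2, j + 2) else (5, 0)
  | 5 => (0, 0)
  | 6 => if j < q - 2 then (2, N - (j + 2)) else (3, 0)
  | 7 => (2, q.*2) | 8 => (2, 0)
  | 9 => if j < q - 2 then (1, j + 2) else (4, 0)
  | 10 => if j < q - 2 then (1, N - (j + 2)) else (5, 0)
  | 11 => (1, 1)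
  | 12 => if j < q - 2 then (0, j + 2) else (3, 0)
  | 13 => if j < q - 2 then (0, N - (j + 2)) else (4, 0)
  | 14 => (1, q.*2) | 15 => (2, q) | 16 => (0, q) | 17 => (1, q.+1)
  | 18 => (1, q) | 19 => (2, q.+1) | _ => (0, q.+1)
  end.

(* The shifts 0, 1, 2 of the ring get one path more, through two of x, y, z. *)
Definition ring_cnt (i a : nat) : nat :=
  match a with
  | 4 | 6 => q - 2 + (i == 0) | 12 | 13 => q - 2 + (i == 1)
  | 9 | 10 => q - 2 + (i == 2) | _ => 1
  end.

Definition ring_vtx (i a j : nat) : 'I_6 * 'I_N :=
  let: (c, k) := ring_lab a j in vtx c (if c < 3 then i + k else 0).

(** A left inverse of [ring_lab], so that injectivity takes one case for each node rather than one
    for each pair of nodes. *)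
Definition ring_unlab (i c k : nat) : nat * nat :=
  let body (h0 h5 a h3 r b h4 : nat) :=
    if k == 0 then (h0, 0) else if k == 1 then (h5, 0)
    else if k < q then (a, k - 2) else if k == q then (h3, 0)
    else if k == q.+1 then (r, 0) else if k < q.*2 then (b, q.*2 - 1 - k)
    else (h4, 0) in
  match c with
  | 0 => body 5 1 12 16 20 13 0
  | 1 => body 2 11 9 18 17 10 14
  | 2 => body 8 3 4 15 19 6 7
  | 3 => if i == 0 then (6, q - 2) else (12, q - 2)
  | 4 => if i == 1 then (13, q - 2) else (9, q - 2)
  | _ => if i == 0 then (4, q - 2) else (10, q - 2)
  end.

Lemma ring_labK i a j : a < 21 -> j < ring_cnt i a ->
  let: (c, k) := ring_lab a j in
  [/\ ring_unlab i c k = (a, j), c < 6, k < N & 2 < c -> k = 0].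
Proof.
do 21 (case: a => [|a]; first by move=> _ /=; rewrite /N;
  repeat (case: ifP => ?); move=> *; split=> //=;
  repeat (case: ifP => ?); try (congr (_, _)); lia).
by [].
Qed.

Lemma ring_vtx_inj i a j b k : a < 21 -> b < 21 ->
  j < ring_cnt i a -> k < ring_cnt i b -> ring_vtx i a j = ring_vtx i b k ->
  a = b /\ j = k.
Proof.
move=> a21 b21 ja kb; have := ring_labK a21 ja; have := ring_labK b21 kb.
rewrite /ring_vtx; case: (ring_lab a j) => c1 k1; case: (ring_lab b k) => c2 k2.
move=> [E2 c26 k2N z2] [E1 c16 k1N z1] /(vtx_inj c16 c26)[cE kE].
suff kE' : k1 = k2 by move: E1; rewrite cE kE' E2 => -[-> ->].
subst c2; move: kE z1 z2; case: ltnP => c3 kE z1 z2; last by rewrite z1 ?z2.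
by apply/eqP; move/eqP: kE; rewrite eqn_modDl !modn_small.
Qed.

Definition ring_rel i := plan_rel ring_plan ring_blk 21 (ring_cnt i) (ring_vtx i).

Lemma ring_rel_book6 i : book6 (ring_rel i).
Proof. by apply: plan_rel_book6 ring_plan_ok _ => a j b k; exact: ring_vtx_inj. Qed.

Lemma ring_edge i a j b k c1 k1 c2 k2 :
  ring_lab a j = (c1, k1) -> ring_lab b k = (c2, k2) ->
  [&& a < 21, b < 21, j < ring_cnt i a & k < ring_cnt i b] ->
  plan_edge ring_plan ring_blk (a, j) (b, k) ->
  ring_rel i (vtx c1 (if c1 < 3 then i + k1 else 0))
             (vtx c2 (if c2 < 3 then i + k2 else 0)).
Proof.
by move=> aE bE H E; have := plan_relI (ring_vtx i) H E; rewrite /ring_vtx aE bE.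
Qed.

Lemma ring_rung i c j : c < 3 -> 0 < j < q ->
  ring_rel i (vtx c (i + j)) (vtx c (i + (N - j))).
Proof.
(* The path with [j = 1] has nodes of its own, because additional edges of the plan end there. *)
move=> c3 /andP[j0 jq]; have [j1|j1] := leqP j 1.
  have {j0 j1} -> : j = 1 by lia.
  have -> : N - 1 = q.*2 by rewrite /N; lia.
  case: c c3 => [|[|[|//]]] _.
  - exact: (@ring_edge i 1 0 0 0 0 1 0).
  - exact: (@ring_edge i 11 0 14 0 1 1 1).
  - exact: (@ring_edge i 3 0 7 0 2 1 2).
have jE : (j - 2 < q - 2) /\ j - 2 + 2 = j by lia.
case: c c3 => [|[|[|//]]] _.
- apply: (@ring_edge i 12 (j - 2) 13 (j - 2) 0 j 0 (N - j)); rewrite /ring_lab ?jE.1 ?jE.2 //.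
    by rewrite /=; lia.
  by rewrite /plan_edge /= eqxx.
- apply: (@ring_edge i 9 (j - 2) 10 (j - 2) 1 j 1 (N - j)); rewrite /ring_lab ?jE.1 ?jE.2 //.
    by rewrite /=; lia.
  by rewrite /plan_edge /= eqxx.
- apply: (@ring_edge i 4 (j - 2) 6 (j - 2) 2 j 2 (N - j)); rewrite /ring_lab ?jE.1 ?jE.2 //.
    by rewrite /=; lia.
  by rewrite /plan_edge /= eqxx.
Qed.

Lemma ring_step i c : c < 3 -> ring_rel i (vtx c (i + 0)) (vtx c (i + 1)).
Proof.
case: c => [|[|[|//]]] _.
- exact: (@ring_edge i 5 0 1 0 0 0 0 1).
- exact: (@ring_edge i 2 0 11 0 1 0 1 1).
- exact: (@ring_edge i 8 0 3 0 2 0 2 1).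
Qed.

Lemma ring_spoke i c j : c < 3 -> 0 < j < q ->
  ring_rel i (vtx c (i + j)) (vtx (c.+1 %% 3) (i + 0)).
Proof.
move=> c3 /andP[j0 jq]; have [j1|j1] := leqP j 1.
  have {j0 j1} -> : j = 1 by lia.
  case: c c3 => [|[|[|//]]] _.
  - exact: (@ring_edge i 1 0 2 0 0 1 1 0).
  - exact: (@ring_edge i 11 0 8 0 1 1 2 0).
  - exact: (@ring_edge i 3 0 5 0 2 1 0 0).
have jE : (j - 2 < q - 2) /\ j - 2 + 2 = j by lia.
case: c c3 => [|[|[|//]]] _.
- by apply: (@ring_edge i 12 (j - 2) 2 0 0 j 1 0); rewrite /ring_lab ?jE.1 ?jE.2 //=; lia.
- by apply: (@ring_edge i 9 (j - 2) 8 0 1 j 2 0); rewrite /ring_lab ?jE.1 ?jE.2 //=; lia.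
- by apply: (@ring_edge i 4 (j - 2) 5 0 2 j 0 0); rewrite /ring_lab ?jE.1 ?jE.2 //=; lia.
Qed.

Lemma ring_spoke' i c j : c < 3 -> 0 < j < q ->
  ring_rel i (vtx c (i + q)) (vtx (c.+1 %% 3) (i + (N - j))).
Proof.
move=> c3 /andP[j0 jq]; have [j1|j1] := leqP j 1.
  have {j0 j1} -> : j = 1 by lia.
  have -> : N - 1 = q.*2 by rewrite /N; lia.
  case: c c3 => [|[|[|//]]] _.
  - exact: (@ring_edge i 16 0 14 0 0 q 1).
  - exact: (@ring_edge i 18 0 7 0 1 q 2).
  - exact: (@ring_edge i 15 0 0 0 2 q 0).
have jE : (j - 2 < q - 2) /\ j - 2 + 2 = j by lia.
case: c c3 => [|[|[|//]]] _.
- by apply: (@ring_edge i 16 0 10 (j - 2) 0 q 1 (N - j)); rewrite /ring_lab ?jE.1 ?jE.2 //=; lia.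
- by apply: (@ring_edge i 18 0 6 (j - 2) 1 q 2 (N - j)); rewrite /ring_lab ?jE.1 ?jE.2 //=; lia.
- by apply: (@ring_edge i 15 0 13 (j - 2) 2 q 0 (N - j)); rewrite /ring_lab ?jE.1 ?jE.2 //=; lia.
Qed.

Lemma ring_link i c : c < 3 ->
  ring_rel i (vtx c (i + q.*2)) (vtx (c.+1 %% 3) (i + q)).
Proof.
case: c => [|[|[|//]]] _.
- exact: (@ring_edge i 0 0 18 0 0 q.*2 1 q).
- exact: (@ring_edge i 14 0 15 0 1 q.*2 2 q).
- exact: (@ring_edge i 7 0 16 0 2 q.*2 0 q).
Qed.

Lemma ring_pendant i c : c < 2 ->
  ring_rel i (vtx c (i + q)) (vtx (c.+1 %% 3) (i + q.+1)).
Proof.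
case: c => [|[|//]] _.
- exact: (@ring_edge i 16 0 17 0 0 q 1 q.+1).
- exact: (@ring_edge i 18 0 19 0 1 q 2 q.+1).
Qed.

Lemma ring_pendant' i : ring_rel i (vtx 2 (i + q.+1)) (vtx 0 (i + q.+1)).
Proof. exact: (@ring_edge i 19 0 20 0 2 q.+1 0 q.+1). Qed.

Lemma ring_sym i : symmetric (ring_rel i).
Proof. by have [] := ring_rel_book6 i. Qed.

(* All edges of the complete graph on the classes 0, 1, 2 but the cycle
   A_0 B_0 C_0 A_1 B_1 C_1 etc. *)
Lemma ring_cover_class c u w : c < 3 -> u < N -> w < N -> u != w ->
  exists2 i, i < N & ring_rel i (vtx c u) (vtx c w).
Proof.
move=> c3; wlog uw : u w / u < w => [H|] uN wN uNw.
  have [uw|wu] := ltnP u w; first exact: H.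
  have [||||i iN wu'] := H w u; rewrite ?(eq_sym w) //; first by rewrite ltn_neqAle eq_sym uNw.
  by exists i; rewrite // ring_sym.
have NE : N = q.*2.+1 by [].
(* A difference [j] with [u = i - j] and [w = i + j], or conversely. *)
have [i [j [iN j0 jq H]]] : exists i j, [/\ i < N, 0 < j, j <= q &
    (u = i + j %[mod N] /\ w = i + (N - j) %[mod N]) \/
    (w = i + j %[mod N] /\ u = i + (N - j) %[mod N])].
  have [odd_d|even_d] := boolP (odd (w - u)).
    pose j := (N - (w - u))./2.
    have jE : j.*2 = N - (w - u) by rewrite /j; lia.
    exists ((w + j) %% N), j; rewrite ltn_mod; split=> //; [lia|lia|left].
    rewrite !modnDml; split.
      have -> : w + j + j = u + N by lia.
      by rewrite modnDr.
    have -> : w + j + (N - j) = w + N by lia.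
    by rewrite modnDr.
  pose j := (w - u)./2; have jE : j.*2 = w - u by rewrite /j; lia.
  exists (u + j), j; split; [lia|lia|lia|right].
  split; first by congr (_ %% _); lia.
  have -> : u + j + (N - j) = u + N by lia.
  by rewrite modnDr.
have [jq'|jq'] := ltnP j q.
  have jj : 0 < j < q by rewrite j0.
  exists i => //; case: H => -[/(vtx_mod c)-> /(vtx_mod c)->].
    exact: ring_rung.
  by rewrite ring_sym; exact: ring_rung.
(* As [i - q] is [i + q + 1] modulo [N], this pair is consecutive and is the single edge of
   [ring_step] in the shift [i + q]. *)
have {jq'} jq' : j = q by lia.
subst j; exists ((i + q) %% N); first by rewrite ltn_mod.
have s0 : i + q = (i + q) %% N + 0 %[mod N] by rewrite addn0 modn_mod.
have s1 : i + (N - q) = (i + q) %% N + 1 %[mod N].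
  by rewrite modnDml; congr (_ %% _); clear -NE; lia.
case: H => -[E1 E2]; rewrite (vtx_mod c E1) (vtx_mod c E2) (vtx_mod c s0) (vtx_mod c s1).
  exact: ring_step.
by rewrite ring_sym; exact: ring_step.
Qed.

(** By the residue [d] of [u - w]: spokes for [0 < d < q], the link for [q], the spokes at the other
    hub for [q < d < 2 * q]. The pendants give [d = 2 * q] if [c < 2] and [d = 0] if [c = 2]. *)
Lemma ring_cover_next c u w : c < 3 -> u < N -> w < N ->
  (if c < 2 then u != w else w != u.+1 %% N) ->
  exists2 i, i < N & ring_rel i (vtx c u) (vtx (c.+1 %% 3) w).
Proof.
move=> c3 uN wN uw; have NE : N = q.*2.+1 by [].
have sh c' x i k : x = i + k %[mod N] -> vtx c' x = vtx c' (i + k) by exact: vtx_mod.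
pose d := (u + (N - w)) %% N.
have dN : d < N by rewrite ltn_mod.
have dE : u = w + d %[mod N].
  by rewrite modnDmr; (have -> : w + (u + (N - w)) = u + N by lia); rewrite modnDr.
have [d0|d0] := posnP d.
  have {dE} uw' : u = w by move: dE; rewrite d0 addn0 !modn_small.
  have c2 : c = 2 by move: uw; case: ifP => [_|]; [rewrite uw' eqxx|lia].
  subst c w; exists ((u + q) %% N); first by rewrite ltn_mod.
  have E : u = (u + q) %% N + q.+1 %[mod N].
    by rewrite modnDml; (have -> : u + q + q.+1 = u + N by lia); rewrite modnDr.
  by rewrite (sh 2 _ _ _ E) (sh 0 _ _ _ E); exact: ring_pendant'.
have [dq|dq] := ltnP d q.
  exists w => //; rewrite (sh _ _ _ _ dE) -[X in vtx (_ %% _) X]addn0.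
  by apply: ring_spoke => //; rewrite d0.
have [dq'|dq'] := eqVneq d q.
  exists (u.+1 %% N); first by rewrite ltn_mod.
  have E1 : u = u.+1 %% N + q.*2 %[mod N].
    by rewrite modnDml; (have -> : u.+1 + q.*2 = u + N by clear -NE; lia); rewrite modnDr.
  have E2 : w = u.+1 %% N + q %[mod N].
    have /eqP := dE; rewrite dq' -(eqn_modDr q.+1) => /eqP E.
    rewrite modnDml addSn -addnS E -addnA.
    have -> : w + (q + q.+1) = w + N by clear -NE; lia.
    by rewrite modnDr.
  by rewrite (sh c _ _ _ E1) (sh _ _ _ _ E2); exact: ring_link.
have dq2 : q < d by clear -dq dq'; lia.
have E1 : u = (u + q.+1) %% N + q %[mod N].
  by rewrite modnDml; (have -> : u + q.+1 + q = u + N by clear -NE; lia); rewrite modnDr.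
have [d2q|d2q] := ltnP d q.*2.
  exists ((u + q.+1) %% N); first by rewrite ltn_mod.
  have E2 : w = (u + q.+1) %% N + (N - (d - q)) %[mod N].
    rewrite modnDml; have /eqP := dE; rewrite -(eqn_modDr (q.+1 + (N - (d - q)))) => /eqP.
    rewrite addnA => ->.
    have -> : w + d + (q.+1 + (N - (d - q))) = w + N + N by clear -NE dq2 d2q; lia.
    by rewrite !modnDr.
  rewrite (sh c _ _ _ E1) (sh _ _ _ _ E2); apply: ring_spoke' => //.
  by clear -dq2 d2q; lia.
have d2 : d = q.*2 by clear -d2q dN NE; lia.
have wE : w = u.+1 %[mod N].
  have /eqP := dE; rewrite -(eqn_modDr 1) d2 => /eqP; rewrite !addn1 => ->.
  have -> : (w + q.*2).+1 = w + N by clear -NE; lia.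
  by rewrite modnDr.
have c2 : c < 2.
  by move: uw; case: ifP => // _; rewrite -wE modn_small // eqxx.
exists ((u + q.+1) %% N); first by rewrite ltn_mod.
have E2 : w = (u + q.+1) %% N + q.+1 %[mod N].
  rewrite modnDml wE; have -> : u + q.+1 + q.+1 = u.+1 + N by clear -NE; lia.
  by rewrite modnDr.
by rewrite (sh c _ _ _ E1) (sh _ _ _ _ E2); exact: ring_pendant.
Qed.
End Family.

(** * The three additional vertices x, y, z *)

Section Hubs.
Variable q : nat.
Hypothesis q2 : 1 < q.
Let N := q.*2.+1.
Local Notation vtx := (vtx q).
Local Notation ring_rel := (@ring_rel q).

(** In the shift [i], the vertex [h] can only be the copy named by [ring_unlab]; if that index is
    out of range, [h] does not occur. *)
Lemma ring_isolated i h : 2 < h < 6 ->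
  ~~ ((ring_unlab q i h 0).2 < ring_cnt q i (ring_unlab q i h 0).1) ->
  forall y, ~~ ring_rel i (vtx h 0) y.
Proof.
move=> /andP[h2 h6] hN; apply: plan_rel_isolated => a j a21 ja.
have := ring_labK q2 a21 ja; rewrite /ring_vtx; case: (ring_lab q a j) => c k [E c6 kN k0].
apply: contra hN => /eqP /(vtx_inj h6 c6)[hc _].
by rewrite hc -(k0 ltac:(lia)) E.
Qed.

(** In the shifts 0 and 1, x lies on an additional path that joins it to B_q and B_1. Any other
    shift [i] joins x to B_i, except that the shift [q] supplies the missing B_0. The same pattern
    is moved by 1 for y with the class C, and by 2 for z with the class A, up to which two shifts
    have the paths. *)
Definition shift_x i := if i == 0 then q else if i == q then q.+1 else 0.
Definition shift_y i := if i == 1 then q else if i == q.+1 then q.+1 else 0.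
Definition shift_z i := if i == 2 then q else if i == q.+2 then q.+1 else 0.

Definition hub_rel i :=
  add_pendant (add_pendant (add_pendant (ring_rel i)
    (vtx 3 0) (vtx 1 (i + shift_x i))) (vtx 4 0) (vtx 2 (i + shift_y i)))
    (vtx 5 0) (vtx 0 (i + shift_z i)).

Lemma hub_rel_book6 i : book6 (hub_rel i).
Proof. by do !apply: book6_add_pendant; exact: ring_rel_book6. Qed.

Lemma ring_sub_hub i : subrel (ring_rel i) (hub_rel i).
Proof. by move=> u v uv; do !apply: sub_add_pendant. Qed.

Lemma vtx_neq c c' k k' : c < 6 -> c' < 6 -> c != c' -> vtx c k != vtx c' k'.
Proof. by move=> c6 c'6; apply: contraNneq => /(vtx_inj c6 c'6)[->]. Qed.

Lemma hub_x u : u < N -> exists2 i, i < N & hub_rel i (vtx 3 0) (vtx 1 u).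
Proof.
move=> uN; have NE : N = q.*2.+1 by [].
have pend i : i != 0 -> i != 1 -> hub_rel i (vtx 3 0) (vtx 1 (i + shift_x i)).
  move=> i0 i1; do 2 apply: sub_add_pendant; apply: add_pendant_edge; first exact: vtx_neq.
  by apply: ring_isolated; rewrite //= (negPf i0) /= (negPf i1) addn0 ltnn.
have [->|uq] := eqVneq u q.
  exists 0 => //; apply: ring_sub_hub.
  by apply: (@ring_edge q 0 6 (q - 2) 18 0 3 0 1 q); rewrite //= ?ltnn //=; lia.
have [->|u0] := eqVneq u 0.
  exists q; first lia.
  have -> : vtx 1 0 = vtx 1 (q + shift_x q).
    apply: vtx_mod; rewrite /shift_x eqxx ifN; last lia.
    by rewrite mod0n; (have -> : q + q.+1 = N by lia); rewrite modnn.
  by apply: pend; lia.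
have [->|u1] := eqVneq u 1.
  exists 1; first lia.
  apply: ring_sub_hub; rewrite ring_sym //.
  by apply: (@ring_edge q 1 2 0 12 (q - 2) 1 0 3 0); rewrite //= ?ltnn //=; lia.
by exists u => //; have := pend u u0 u1; rewrite /shift_x (negPf u0) (negPf uq) addn0.
Qed.

Lemma hub_y u : u < N -> exists2 i, i < N & hub_rel i (vtx 4 0) (vtx 2 u).
Proof.
move=> uN; have NE : N = q.*2.+1 by [].
have pend i : i != 1 -> i != 2 -> hub_rel i (vtx 4 0) (vtx 2 (i + shift_y i)).
  move=> i1 i2; apply: sub_add_pendant; apply: add_pendant_edge; first exact: vtx_neq.
  apply: add_pendant_isolated; try exact: vtx_neq.
  by apply: ring_isolated; rewrite //= (negPf i1) /= (negPf i2) addn0 ltnn.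
have [->|uq] := eqVneq u q.+1.
  exists 1; first lia.
  apply: ring_sub_hub; rewrite -add1n.
  by apply: (@ring_edge q 1 13 (q - 2) 15 0 4 0 2 q); rewrite //= ?ltnn //=; lia.
have [->|u1] := eqVneq u 1.
  exists q.+1; first lia.
  have -> : vtx 2 1 = vtx 2 (q.+1 + shift_y q.+1).
    apply: vtx_mod; rewrite /shift_y eqxx ifN; last lia.
    by (have -> : q.+1 + q.+1 = 1 + N by lia); rewrite modnDr.
  by apply: pend; lia.
have [->|u2] := eqVneq u 2.
  exists 2; first lia.
  apply: ring_sub_hub; rewrite ring_sym // -[X in vtx 2 X]addn0.
  by apply: (@ring_edge q 2 8 0 9 (q - 2) 2 0 4 0); rewrite //= ?ltnn //=; lia.
by exists u => //; have := pend u u1 u2; rewrite /shift_y (negPf u1) (negPf uq) addn0.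
Qed.

Lemma hub_z u : u < N -> exists2 i, i < N & hub_rel i (vtx 5 0) (vtx 0 u).
Proof.
move=> uN; have NE : N = q.*2.+1 by [].
have pend i : i != 0 -> i != 2 -> hub_rel i (vtx 5 0) (vtx 0 (i + shift_z i)).
  move=> i0 i2; apply: add_pendant_edge; first exact: vtx_neq.
  do 2 (apply: add_pendant_isolated; try exact: vtx_neq).
  by apply: ring_isolated; rewrite //= (negPf i0) /= (negPf i2) addn0 ltnn.
have [->|uq] := eqVneq u q.+2.
  exists 2; first lia.
  apply: ring_sub_hub; rewrite -add2n.
  by apply: (@ring_edge q 2 10 (q - 2) 16 0 5 0 0 q); rewrite //= ?ltnn //=; lia.
have [->|u2] := eqVneq u 2.
  exists q.+2; first lia.
  have -> : vtx 0 2 = vtx 0 (q.+2 + shift_z q.+2).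
    apply: vtx_mod; rewrite /shift_z eqxx ifN; last lia.
    by (have -> : q.+2 + q.+1 = 2 + N by lia); rewrite modnDr.
  by apply: pend; lia.
have [->|u0] := eqVneq u 0.
  exists 0 => //; apply: ring_sub_hub; rewrite ring_sym //.
  by apply: (@ring_edge q 0 5 0 4 (q - 2) 0 0 5 0); rewrite //= ?ltnn //=; lia.
by exists u => //; have := pend u u0 u2; rewrite /shift_z (negPf u2) (negPf uq) addn0.
Qed.

Lemma hub_hub : [/\ hub_rel 0 (vtx 5 0) (vtx 3 0), hub_rel 1 (vtx 3 0) (vtx 4 0) &
  hub_rel 2 (vtx 4 0) (vtx 5 0)].
Proof.
split; apply: ring_sub_hub.
- apply: (@ring_edge q 0 4 (q - 2) 6 (q - 2) 5 0 3 0);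
  by rewrite /plan_edge /= ?ltnn ?eqxx //=; lia.
- apply: (@ring_edge q 1 12 (q - 2) 13 (q - 2) 3 0 4 0);
  by rewrite /plan_edge /= ?ltnn ?eqxx //=; lia.
- apply: (@ring_edge q 2 9 (q - 2) 10 (q - 2) 4 0 5 0);
  by rewrite /plan_edge /= ?ltnn ?eqxx //=; lia.
Qed.

Definition tri_cnt (a : nat) : nat := if a < 6 then q else 1.

(* The two graphs formed by stars at x, y, z and by every other edge of the
   cycle A_0 B_0 C_0 A_1 B_1 C_1 etc. *)
Definition tri_lab (b : bool) (a j : nat) : nat * nat :=
  match a with
  | 0 => if b then (1, j.*2.+1) else (2, j.*2.+1)
  | 1 => if b then (2, j.*2.+1) else (0, j.*2.+2)
  | 2 => if b then (1, j.*2.+2) else (2, j.*2)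
  | 3 => if b then (0, j.*2.+2) else (1, j.*2)
  | 4 => if b then (0, j.*2.+1) else (1, j.*2.+1)
  | 5 => if b then (2, j.*2) else (0, j.*2.+1)
  | 6 => if b then (5, 0) else (4, 0)
  | 7 => if b then (0, 0) else (1, q.*2)
  | 8 => if b then (3, 0) else (5, 0)
  | 9 => if b then (1, 0) else (2, q.*2)
  | 10 => if b then (2, q.*2) else (0, 0)
  | _ => if b then (4, 0) else (3, 0)
  end.

Definition tri_unlab (b : bool) (c k : nat) : nat * nat :=
  match c with
  | 0 => if b then (if k == 0 then (7, 0) else if odd k then (4, k./2) else (3, k./2.-1))
         else (if k == 0 then (10, 0) else if odd k then (5, k./2) else (1, k./2.-1))
  | 1 => if b then (if k == 0 then (9, 0) else if odd k then (0, k./2) else (2, k./2.-1))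
         else (if k == q.*2 then (7, 0) else if odd k then (4, k./2) else (3, k./2))
  | 2 => if b then (if k == q.*2 then (10, 0) else if odd k then (1, k./2) else (5, k./2))
         else (if k == q.*2 then (9, 0) else if odd k then (0, k./2) else (2, k./2))
  | 3 => if b then (8, 0) else (11, 0)
  | 4 => if b then (11, 0) else (6, 0)
  | _ => if b then (6, 0) else (8, 0)
  end.

Lemma tri_labK b a j : a < 12 -> j < tri_cnt a ->
  let: (c, k) := tri_lab b a j in [/\ tri_unlab b c k = (a, j), c < 6 & k < N].
Proof.
rewrite /tri_cnt.
do 12 (case: a => [|a]; first by move=> _ /=; rewrite /N; case: b => /= *; split=> //=;
  repeat (case: ifP => ?); try (congr (_, _)); lia).
by [].
Qed.

Definition tri_vtx (b : bool) (a j : nat) := vtx (tri_lab b a j).1 (tri_lab b a j).2.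

Definition tri_rel b := plan_rel triangle_plan triangle_blk 12 tri_cnt (tri_vtx b).

Lemma tri_rel_book6 b : book6 (tri_rel b).
Proof.
apply: plan_rel_book6 triangle_plan_ok _ => a j a' j' a12 a'12 ja ja'.
have := tri_labK b a12 ja; have := tri_labK b a'12 ja'; rewrite /tri_vtx.
case: (tri_lab b a j) => c k; case: (tri_lab b a' j') => c' k'.
move=> [E' c'6 k'N] [E c6 kN] /(vtx_inj c6 c'6) /= [cE].
by rewrite !modn_small // => kE; move: E; rewrite cE kE E' => -[-> ->].
Qed.

Lemma tri_edge b a j a' j' c k c' k' :
  tri_lab b a j = (c, k) -> tri_lab b a' j' = (c', k') ->
  [&& a < 12, a' < 12, j < tri_cnt a & j' < tri_cnt a'] ->
  plan_edge triangle_plan triangle_blk (a, j) (a', j') ->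
  tri_rel b (vtx c k) (vtx c' k').
Proof.
by move=> aE a'E H E; have := plan_relI (tri_vtx b) H E; rewrite /tri_vtx aE a'E.
Qed.

Lemma odd_even_cases u : u < N -> [\/ u = 0, exists2 j, j < q & u = j.*2.+1 |
  exists2 j, j < q & u = j.*2.+2].
Proof.
rewrite /N => uN; case: u uN => [|u] uN; first by constructor 1.
have [ou|eu] := boolP (odd u); last by constructor 2; exists u./2; lia.
by constructor 3; exists u./2; lia.
Qed.

Lemma odd_even_cases' u : u < N -> [\/ u = q.*2, exists2 j, j < q & u = j.*2.+1 |
  exists2 j, j < q & u = j.*2].
Proof.
rewrite /N => uN; have [->|uq] := eqVneq u q.*2; first by constructor 1.
have [ou|eu] := boolP (odd u); first by constructor 2; exists u./2; lia.
by constructor 3; exists u./2; lia.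
Qed.

(** Here x, y, z are joined to the classes A, B, C; in [tri_star2] to C, A, B; in the graphs
    [hub_rel] to B, C, A. *)
Lemma tri_star1 c u : c < 3 -> u < N -> tri_rel true (vtx (3 + c) 0) (vtx c u).
Proof.
case: c => [|[|[|//]]] _.
- case/odd_even_cases => [->|[j jq ->]|[j jq ->]].
  + exact: (@tri_edge true 8 0 7 0).
  + exact: (@tri_edge true 8 0 4 j).
  + exact: (@tri_edge true 8 0 3 j).
- case/odd_even_cases => [->|[j jq ->]|[j jq ->]].
  + exact: (@tri_edge true 11 0 9 0).
  + exact: (@tri_edge true 11 0 0 j).
  + exact: (@tri_edge true 11 0 2 j).
- case/odd_even_cases' => [->|[j jq ->]|[j jq ->]].
  + exact: (@tri_edge true 6 0 10 0).
  + exact: (@tri_edge true 6 0 1 j).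
  + exact: (@tri_edge true 6 0 5 j).
Qed.

Lemma tri_star2 c u : c < 3 -> u < N ->
  tri_rel false (vtx (3 + c.+1 %% 3) 0) (vtx c u).
Proof.
case: c => [|[|[|//]]] _.
- case/odd_even_cases => [->|[j jq ->]|[j jq ->]].
  + exact: (@tri_edge false 6 0 10 0).
  + exact: (@tri_edge false 6 0 5 j).
  + exact: (@tri_edge false 6 0 1 j).
- case/odd_even_cases' => [->|[j jq ->]|[j jq ->]].
  + exact: (@tri_edge false 8 0 7 0).
  + exact: (@tri_edge false 8 0 4 j).
  + exact: (@tri_edge false 8 0 3 j).
- case/odd_even_cases' => [->|[j jq ->]|[j jq ->]].
  + exact: (@tri_edge false 11 0 9 0).
  + exact: (@tri_edge false 11 0 0 j).
  + exact: (@tri_edge false 11 0 2 j).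
Qed.

(** The cycle has odd length, so its edges cannot alternate throughout: C_(2q) A_0 and A_0 B_0 both
    fall to the graph [true], on its additional paths. *)
Lemma tri_cycle c u : c < 3 -> u < N ->
  exists b, tri_rel b (vtx c u) (vtx (c.+1 %% 3) (if c < 2 then u else u.+1)).
Proof.
case: c => [|[|[|//]]] _ /=.
- case/odd_even_cases => [->|[j jq ->]|[j jq ->]].
  + by exists true; apply: (@tri_edge true 7 0 9 0).
  + by exists false; apply: (@tri_edge false 5 j 4 j); rewrite // /tri_cnt ?jq // /plan_edge /= eqxx.
  + by exists true; apply: (@tri_edge true 3 j 2 j); rewrite // /tri_cnt ?jq // /plan_edge /= eqxx.
- case/odd_even_cases' => [->|[j jq ->]|[j jq ->]].
  + by exists false; apply: (@tri_edge false 7 0 9 0).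
  + by exists true; apply: (@tri_edge true 0 j 1 j); rewrite // /tri_cnt ?jq // /plan_edge /= eqxx.
  + by exists false; apply: (@tri_edge false 3 j 2 j); rewrite // /tri_cnt ?jq // /plan_edge /= eqxx.
- case/odd_even_cases' => [->|[j jq ->]|[j jq ->]].
  + exists true; rewrite (_ : vtx 0 q.*2.+1 = vtx 0 0); last first.
      by apply: vtx_mod; rewrite modnn mod0n.
    by apply: (@tri_edge true 10 0 7 0).
  + by exists false; apply: (@tri_edge false 0 j 1 j); rewrite // /tri_cnt ?jq // /plan_edge /= eqxx.
  + by exists true; apply: (@tri_edge true 5 j 4 j); rewrite // /tri_cnt ?jq // /plan_edge /= eqxx.
Qed.
End Hubs.

(** * Upper bound *)

Definition cyclic_rel (n : nat) : rel 'I_n := fun i j =>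
  (i.+1 %% n == j) || (j.+1 %% n == i).

Lemma cyclic_rel_book6 (n : nat) : 5 < n -> book6 (@cyclic_rel n).
Proof.
move=> n5; have modS (i : 'I_n) : i.+1 %% n = if i.+1 == n then 0 else i.+1.
  have := ltn_ord i; rewrite leq_eqVlt; case: eqP => [-> _|_ /= lt]; first exact: modnn.
  by rewrite modn_small.
have cases (i j : 'I_n) : cyclic_rel i j ->
    (j = i.+1 :> nat \/ i = j.+1 :> nat) \/
    (i = n.-1 :> nat /\ j = 0 :> nat \/ j = n.-1 :> nat /\ i = 0 :> nat).
  rewrite /cyclic_rel !modS.
  by case/orP; case: ifP => /eqP => [E /eqP|_ /eqP]; lia.
split.
- by move=> i j; rewrite /cyclic_rel orbC.
- by move=> i; apply/negP => /cases; lia.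
- exists val, (fun _ _ => true); split=> [||i j k l /cases ij /cases kl _ /=].
  + exact: val_inj.
  + by [].
  by have := ltn_ord i; have := ltn_ord j; have := ltn_ord k; have := ltn_ord l; lia.
move=> c c3 Uc; have [cc uc] := andP Uc.
case: c c3 cc uc Uc => // x0 c c3 cc uc Uc.
(* A cycle uses two distinct neighbours of [i], hence also its successor; so it contains all [n]
   vertices. *)
have step i : i \in x0 :: c -> forall j : 'I_n, j = i.+1 %% n :> nat -> j \in x0 :: c.
  move=> ic j ji; have [y [z [yz yc zc]]] := ucycle_two_neighbours c3 Uc ic.
  rewrite /cyclic_rel -ji => /orP[/eqP/val_inj->//|/eqP yi] /orP[/eqP zi|/eqP/val_inj->//].
  case/eqP: yz; apply/val_inj => /=; move: yi zi; rewrite !modS.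
  by have := ltn_ord y; have := ltn_ord z; case: ifP => /eqP; case: ifP => /eqP; lia.
have all_c k : forall j : 'I_n, j = (x0 + k) %% n :> nat -> j \in x0 :: c.
  elim: k => [|k IHk] j jE.
    suff -> : j = x0 by rewrite inE eqxx.
    by apply/val_inj; rewrite /= jE addn0 modn_small.
  have n0 : 0 < n by lia.
  have H := IHk (Ordinal (ltn_pmod (x0 + k) n0)) erefl; apply: (step _ H).
  by rewrite jE /= addnS -[in RHS]addn1 modnDml addn1.
apply: leq_trans n5 _; rewrite -[leqLHS]card_ord -(card_uniqP uc).
apply/subset_leq_card/fintype.subsetP => j _; apply: (all_c (n - x0 + j)).
have x0n := ltn_ord x0.
by rewrite addnA subnKC ?(ltnW x0n) // modnDl modn_small.
Qed.

(** * Explicit covers of small complete graphs; [G.1] lists the vertices along the line, and the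
    edges in [G.2] refer to positions in that list *)

Definition small_rel (n : nat) (G : seq nat * seq (nat * nat * bool)) : rel 'I_n.+1 :=
  plan_rel G.2 [::] n.+1 (fun=> 1) (fun a _ => inord (nth 0 G.1 a)).

Definition small_ok (n : nat) (G : seq nat * seq (nat * nat * bool)) : bool :=
  [&& plan_ok G.2 [::] [::] n.+1, uniq G.1, size G.1 == n.+1 & all (fun a => a < n.+1) G.1].

Definition small_joins (G : seq nat * seq (nat * nat * bool)) (u v : nat) : bool :=
  let a := index u G.1 in let b := index v G.1 in
  [|| (a, b, true) \in G.2, (b, a, true) \in G.2, (a, b, false) \in G.2 |
      (b, a, false) \in G.2].

Lemma small_book6_cover (n : nat) (Gs : seq (seq nat * seq (nat * nat * bool))) :
  all (small_ok n) Gs ->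
  all (fun u => all (fun v => (u == v) || has (fun G => small_joins G u v) Gs)
    (iota 0 n.+1)) (iota 0 n.+1) ->
  book6_cover 'I_n.+1 (size Gs).
Proof.
move=> ok cov; exists (fun i => @small_rel n (nth ([::], [::]) Gs i)); split.
  move=> i; have /and4P[Lok Gu /eqP Gs_n Glt] := allP ok _ (mem_nth ([::], [::]) (ltn_ord i)).
  apply: plan_rel_book6 Lok _ => a [|//] b [|//] an bn _ _ H; split=> //.
  have nth_lt x : x < n.+1 -> nth 0 (nth ([::], [::]) Gs i).1 x < n.+1.
    by move=> xn; apply: (allP Glt); rewrite mem_nth ?Gs_n.
  move/(congr1 val): H; rewrite /= !inordK ?nth_lt // => /eqP.
  by rewrite nth_uniq ?Gs_n // => /eqP.
move=> u v uv; have := allP cov u; rewrite mem_iota ltn_ord => /(_ isT).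
move=> /allP/(_ v); rewrite mem_iota ltn_ord => /(_ isT).
case/orP=> [/eqP/val_inj uv'|/(hasP)[G GGs Guv]]; first by rewrite uv' eqxx in uv.
have iG : index G Gs < size Gs by rewrite index_mem.
exists (Ordinal iG) => /=; rewrite nth_index //.
have /and4P[Lok Gu /eqP Gs_n Glt] := allP ok _ GGs.
have G_all (x : 'I_n.+1) : val x \in G.1.
  have sub_iota : {subset G.1 <= iota 0 n.+1}.
    by move=> y yG; rewrite mem_iota (allP Glt).
  have [|_ ->] := uniq_min_size Gu sub_iota; first by rewrite size_iota Gs_n.
  by rewrite mem_iota ltn_ord.
have F_index (x : 'I_n.+1) : inord (nth 0 G.1 (index (val x) G.1)) = x.
  by rewrite nth_index // inord_val.
rewrite -[in X in small_rel _ X](F_index u) -[in X in small_rel _ _ X](F_index v).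
apply: (@plan_relI _ G.2 [::] n.+1 (fun=> 1) (fun a _ => inord (nth 0 G.1 a))
  (index (val u) G.1) 0 (index (val v) G.1) 0).
  have idx (x : 'I_n.+1) : index (val x) G.1 < n.+1 by rewrite -[X in _ < X]Gs_n index_mem.
  by rewrite !idx.
by case/or4P: Guv => H; rewrite /plan_edge /= H ?orbT.
Qed.

Lemma book6_cover2 : book6_cover 'I_2 1.
Proof.
apply: (@small_book6_cover 1
  [:: ([:: 0; 1],
    [:: (0, 1, false)])]);
  by vm_compute.
Qed.

Lemma book6_cover4 : book6_cover 'I_4 2.
Proof.
apply: (@small_book6_cover 3
  [:: ([:: 0; 1; 2; 3],
    [:: (0, 1, false); (1, 2, false); (2, 3, false)]);
   ([:: 1; 3; 0; 2],
    [:: (0, 1, false); (1, 2, false); (2, 3, false)])]);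
  by vm_compute.
Qed.

(** Three Hamiltonian cycles, with steps 1, 2 and 3 modulo 7. *)
Lemma book6_cover7 : book6_cover 'I_7 3.
Proof.
apply: (@small_book6_cover 6
  [:: ([:: 0; 1; 2; 3; 4; 5; 6],
    [:: (0, 1, false); (1, 2, false); (2, 3, false); (3, 4, false);
        (4, 5, false); (5, 6, false); (6, 0, false)]);
   ([:: 0; 2; 4; 6; 1; 3; 5],
    [:: (0, 1, false); (1, 2, false); (2, 3, false); (3, 4, false);
        (4, 5, false); (5, 6, false); (6, 0, false)]);
   ([:: 0; 3; 6; 2; 5; 1; 4],
    [:: (0, 1, false); (1, 2, false); (2, 3, false); (3, 4, false);
        (4, 5, false); (5, 6, false); (6, 0, false)])]);
  by vm_compute.
Qed.

(** Each graph may have at most 12 edges, and 45 are needed; the graphs here have 11, 11, 11 and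
    12. *)
Lemma book6_cover10 : book6_cover 'I_10 4.
Proof.
apply: (@small_book6_cover 9
  [:: ([:: 6; 4; 1; 7; 5; 9; 2; 3; 0; 8],
    [:: (7, 6, false); (0, 1, false); (5, 2, false); (5, 4, false);
        (5, 9, false); (1, 2, true); (4, 6, true); (0, 8, true);
        (3, 2, true); (3, 7, true); (9, 8, true)]);
   ([:: 9; 1; 3; 0; 2; 4; 8; 5; 7; 6],
    [:: (1, 3, false); (4, 1, false); (7, 5, false); (8, 4, false);
        (8, 5, false); (0, 4, false); (0, 9, false); (2, 1, true);
        (7, 2, true); (9, 7, true); (6, 2, true)]);
   ([:: 2; 5; 0; 7; 8; 1; 3; 4; 9; 6],
    [:: (0, 2, false); (6, 2, false); (9, 0, false); (3, 2, false);
        (4, 5, false); (8, 6, false); (8, 7, false); (3, 1, true);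
        (4, 7, true); (4, 1, true); (4, 9, true)]);
   ([:: 9; 7; 3; 5; 4; 8; 2; 0; 1; 6],
    [:: (4, 2, false); (5, 1, false); (0, 7, false); (4, 7, true);
        (4, 6, true); (3, 7, true); (3, 8, true); (9, 8, true);
        (9, 2, true); (1, 9, true); (5, 6, true); (0, 1, true)])]);
  by vm_compute.
Qed.

Lemma book6_cover12 : book6_cover 'I_12 5.
Proof.
apply: (@small_book6_cover 11
  [:: ([:: 4; 0; 7; 5; 11; 8; 3; 1; 6; 9; 2; 10],
    [:: (3, 1, false); (5, 8, false); (11, 0, false); (11, 9, false);
        (4, 8, false); (10, 1, true); (6, 7, true); (6, 10, true);
        (0, 10, true); (2, 3, true); (5, 10, true); (9, 7, true);
        (9, 8, true); (4, 2, true)]);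
   ([:: 11; 7; 10; 0; 9; 4; 3; 8; 5; 1; 2; 6],
    [:: (5, 3, false); (8, 10, false); (11, 6, false); (1, 3, false);
        (7, 6, false); (7, 8, false); (4, 5, false); (0, 6, false);
        (0, 5, false); (10, 9, true); (11, 9, true); (1, 9, true);
        (4, 8, true); (2, 1, true)]);
   ([:: 4; 7; 10; 2; 5; 3; 1; 0; 9; 11; 6; 8],
    [:: (5, 7, false); (1, 0, false); (1, 10, false); (11, 0, false);
        (2, 3, false); (2, 4, false); (9, 2, false); (6, 7, true);
        (4, 0, true); (11, 7, true); (8, 11, true); (9, 8, true)]);
   ([:: 9; 10; 8; 1; 4; 2; 3; 7; 0; 5; 11; 6],
    [:: (4, 3, false); (7, 5, false); (2, 3, false); (1, 11, false);
        (1, 2, false); (10, 8, false); (10, 3, false); (10, 5, false);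
        (11, 9, true); (7, 6, true); (0, 8, true); (0, 6, true);
        (1, 6, true)]);
   ([:: 4; 5; 0; 6; 2; 7; 8; 10; 1; 11; 3; 9],
    [:: (0, 10, false); (1, 8, false); (1, 10, false); (3, 2, false);
        (6, 5, false); (7, 2, false); (9, 1, false); (3, 4, true);
        (3, 0, true); (11, 4, true); (11, 5, true); (7, 8, true);
        (9, 6, true)])]);
  by vm_compute.
Qed.

Section Assembly.
Variable q : nat.
Hypothesis q2 : 1 < q.
Let N := q.*2.+1.

(** In this numbering the cycle A_0 B_0 C_0 A_1 and so on is succession modulo [3 * N]; the last
    three numbers are x, y, z. *)
Let place (x : nat) : 'I_6 * 'I_N :=
  if x < 3 * N then vtx q (x %% 3) (x %/ 3) else vtx q (3 + (x - 3 * N)) 0.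

Let place_inj n : n <= 3 * N + 3 -> injective (fun x : 'I_n => place x).
Proof.
move=> nN x y; rewrite /place; have := ltn_ord x; have := ltn_ord y.
have x3 := ltn_pmod x (isT : 0 < 3); have y3 := ltn_pmod y (isT : 0 < 3).
move=> yn xn; case: ltnP => xN; case: ltnP => yN.
- case/vtx_inj => [||E]; rewrite ?(leq_trans x3) ?(leq_trans y3) //.
  rewrite !modn_small ?ltn_divLR // 1?mulnC // => E'; apply/val_inj.
  by rewrite /= (divn_eq x 3) (divn_eq y 3) E E'.
- by case/vtx_inj => [||E]; lia.
- by case/vtx_inj => [||E]; lia.
- by case/vtx_inj => [||E] *; last apply/val_inj => /=; lia.
Qed.

Let cover_classes (x y : nat) : x < 3 * N -> y < 3 * N -> x != y ->
  (exists2 i, i < N & ring_rel i (place x) (place y)) \/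
  x.+1 %% (3 * N) = y \/ y.+1 %% (3 * N) = x.
Proof.
move=> xN yN xy; rewrite /place xN yN.
have x3 := ltn_pmod x (isT : 0 < 3); have y3 := ltn_pmod y (isT : 0 < 3).
have uN : x %/ 3 < N by rewrite ltn_divLR // mulnC.
have wN : y %/ 3 < N by rewrite ltn_divLR // mulnC.
have succ a b : a < 3 * N -> b < 3 * N -> b %% 3 = (a %% 3).+1 %% 3 ->
    (exists2 i, i < N & ring_rel i (vtx q (a %% 3) (a %/ 3)) (vtx q (b %% 3) (b %/ 3))) \/
    a.+1 %% (3 * N) = b.
  move=> aN bN ab; have a3 := ltn_pmod a (isT : 0 < 3).
  have uaN : a %/ 3 < N by rewrite ltn_divLR // mulnC.
  have wbN : b %/ 3 < N by rewrite ltn_divLR // mulnC.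
  rewrite ab.
  have [H|H] := boolP (if a %% 3 < 2 then a %/ 3 != b %/ 3 else b %/ 3 != (a %/ 3).+1 %% N).
    by left; exact: ring_cover_next.
  right; move: H; case: ifP => a2; rewrite negbK => /eqP H.
    by rewrite modn_small; lia.
  have a2' : a %% 3 = 2 by lia.
  rewrite (divn_eq b 3) H ab a2' /= addn0 muln_modl mulnC; congr (_ %% _); lia.
have [xy3|xy3] := eqVneq (x %% 3) (y %% 3).
  left; rewrite xy3; apply: ring_cover_class => //.
  by apply: contra xy => /eqP E; rewrite (divn_eq x 3) E xy3 -divn_eq.
have [yx|yx] : y %% 3 = (x %% 3).+1 %% 3 \/ x %% 3 = (y %% 3).+1 %% 3.
  by move: x3 y3 xy3; case: (x %% 3) => [|[|[|]]] //; case: (y %% 3) => [|[|[|]]] //; tauto.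
- by have [|->] := succ x y xN yN yx; tauto.
- have [[i iN E]|->] := succ y x yN xN yx; last by tauto.
  by left; exists i; rewrite // ring_sym.
Qed.

Lemma book6_cover_odd : book6_cover 'I_(3 * N) N.+1.
Proof.
have le : 3 * N <= 3 * N + 3 by lia.
exists (fun (i : 'I_N.+1) (x y : 'I_(3 * N)) => if i < N then ring_rel i (place x) (place y) else cyclic_rel x y).
split=> [i|x y xy].
  case: (i < N); last by apply: cyclic_rel_book6; rewrite /N; lia.
  exact: book6_preim (place_inj le) (ring_rel_book6 q2 i).
have [[i iN E]|E] := cover_classes (ltn_ord x) (ltn_ord y) xy.
  by exists (inord i); rewrite inordK ?iN // ltnS ltnW.
exists ord_max; rewrite /= ltnn; apply/orP.
by case: E => ->; [left|right].
Qed.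

Lemma book6_cover_even : book6_cover 'I_(3 * N.+1) N.+2.
Proof.
have le : 3 * N.+1 <= 3 * N + 3 by lia.
pose E i := if i < N then @hub_rel q i else @tri_rel q (i == N).
have Ebook6 i : book6 (E i).
  by rewrite /E; case: ifP => _; [exact: hub_rel_book6|exact: tri_rel_book6].
exists (fun (i : 'I_N.+2) (x y : 'I_(3 * N.+1)) => E i (place x) (place y)); split=> [i|x y xy].
  exact: book6_preim (place_inj le) (Ebook6 i).
suff [i [iN Eij]] : exists i, i < N.+2 /\ E i (place x) (place y).
  by exists (inord i); rewrite inordK.
have hubE i u v : i < N -> @hub_rel q i u v -> exists i, i < N.+2 /\ E i u v.
  by move=> iN H; exists i; rewrite /E iN; split=> //; lia.
have triE b u v : @tri_rel q b u v -> exists i, i < N.+2 /\ E i u v.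
  move=> H; exists (N + ~~ b); rewrite /E ifN; last lia.
  by split; [lia|case: b H => /=; rewrite ?addn0 ?eqxx // addn1 eqn_leq ltnn].
have Esym u v : (exists i, i < N.+2 /\ E i u v) -> exists i, i < N.+2 /\ E i v u.
  by move=> [i [iN H]]; exists i; split=> //; have [-> _ _ _] := Ebook6 i.
have hub h x' : x' < 3 * N -> 2 < h < 6 ->
    exists i, i < N.+2 /\ E i (vtx q h 0) (place x').
  move=> x'N h6; rewrite /place x'N.
  have uN : x' %/ 3 < N by rewrite ltn_divLR // mulnC.
  have := ltn_pmod x' (isT : 0 < 3); set c := x' %% 3 => c3.
  have [hc|hc] := eqVneq h (3 + c); first by rewrite hc; apply/(triE true)/tri_star1.
  have [hc'|hc'] := eqVneq h (3 + c.+1 %% 3).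
    by rewrite hc'; apply/(triE false)/tri_star2.
  move: c3 hc hc' h6; case: c => [|[|[|//]]] _;
    case: h => [|[|[|[|[|[|//]]]]]] //= _ _ _.
  - by have [i iN /hubE] := hub_z q2 uN; exact.
  - by have [i iN /hubE] := hub_x q2 uN; exact.
  - by have [i iN /hubE] := hub_y q2 uN; exact.
have [xN|xN] := ltnP x (3 * N); have [yN|yN] := ltnP y (3 * N).
- have [[i iN /ring_sub_hub/hubE]|] := cover_classes xN yN xy; first exact.
  have nextE a b : a < 3 * N -> b < 3 * N -> a.+1 %% (3 * N) = b ->
      exists i, i < N.+2 /\ E i (place a) (place b).
    move=> aN bN ab; have a3 := ltn_pmod a (isT : 0 < 3).
    have uN : a %/ 3 < N by rewrite ltn_divLR // mulnC.
    have [b' /triE] := tri_cycle q2 a3 uN; rewrite /place aN bN.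
    suff -> : vtx q (b %% 3) (b %/ 3) =
      vtx q ((a %% 3).+1 %% 3) (if a %% 3 < 2 then a %/ 3 else (a %/ 3).+1) by [].
    case: ltnP => a2.
      have bE : b = a.+1 by rewrite -ab modn_small //; have := divn_eq a 3; lia.
      by congr (vtx q _ _); lia.
    have a2' : a %% 3 = 2 by lia.
    have bE : b = (a %/ 3).+1 %% N * 3.
      by rewrite -ab muln_modl mulnC; congr (_ %% _); lia.
    by rewrite bE modnMl mulnK // a2'; apply: vtx_mod; rewrite modn_mod.
  by case=> H; [exact: nextE|apply: Esym; exact: nextE].
- have -> : place y = vtx q (3 + (y - 3 * N)) 0 by rewrite /place ifN // -leqNgt.
  by apply: Esym; apply: hub; have := ltn_ord y; lia.
- have -> : place x = vtx q (3 + (x - 3 * N)) 0 by rewrite /place ifN // -leqNgt.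
  by apply: hub; have := ltn_ord x; lia.
have -> : place y = vtx q (3 + (y - 3 * N)) 0 by rewrite /place ifN // -leqNgt.
have -> : place x = vtx q (3 + (x - 3 * N)) 0 by rewrite /place ifN // -leqNgt.
have [H1 H2 H3] := hub_hub q2.
have N3 : 2 < N by rewrite /N; lia.
have [x3 y3] : x - 3 * N < 3 /\ y - 3 * N < 3.
  by have := ltn_ord x; have := ltn_ord y; lia.
have {xy} : x - 3 * N != y - 3 * N.
  by apply: contra xy => /eqP xy; apply/eqP/val_inj => /=; lia.
move: x3 y3; case: (x - 3 * N) => [|[|[|//]]] _; case: (y - 3 * N) => [|[|[|//]]] _ // _.
- by apply: hubE H2; lia.
- by apply: Esym; apply: hubE H1; lia.
- by apply: Esym; apply: hubE H2; lia.
- by apply: hubE H3; lia.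
- by apply: hubE H1; lia.
- by apply: Esym; apply: hubE H3; lia.
Qed.
End Assembly.

Local Open Scope ring_scope.

Lemma book6_cover_widen (n m k : nat) : (n <= m)%N ->
  book6_cover 'I_m k -> book6_cover 'I_n k.
Proof.
move=> nm; apply: (book6_cover_preim (f := widen_ord nm)) => x y.
by move/(congr1 val) => /= /val_inj.
Qed.

Lemma book6_cover_mul3 (t : nat) : (0 < t)%N -> book6_cover 'I_(3 * t) t.+1.
Proof.
case: t => [|[|[|[|[|t]]]]] // _.
- by apply: book6_cover_widen book6_cover4.
- by apply: book6_cover_widen book6_cover7.
- by apply: book6_cover_widen book6_cover10.
- by apply: book6_cover_widen book6_cover12.
have [odd_t|even_t] := boolP (odd t).
  have q2 : (1 < (t.+4)./2)%N by lia.
  have -> : t.+1.+4 = ((t.+4)./2).*2.+2 by lia.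
  exact: book6_cover_even q2.
have q2 : (1 < (t.+4)./2)%N by lia.
have -> : t.+1.+4 = ((t.+4)./2).*2.+1 by lia.
exact: book6_cover_odd q2.
Qed.

Lemma complete_book6_cover (n : nat) : (1 <= n)%N -> n <> 2%N ->
  ~ (exists t : nat, (4 <= t)%N /\ n = (3 * t + 1)%N) ->
  book6_cover 'I_n ((n + 4) %/ 3)%N.
Proof.
move=> n1 n2 n3t.
have [n0|[n0|n0]] : (n %% 3 = 0 \/ n %% 3 = 1 \/ n %% 3 = 2)%N.
  by have := ltn_pmod n (isT : 0 < 3)%N; lia.
- have -> : ((n + 4) %/ 3 = (n %/ 3).+1)%N by lia.
  by apply: book6_cover_widen (book6_cover_mul3 (_ : 0 < n %/ 3)%N); lia.
- have [n4|n4] := leqP 13 n; first by case: n3t; exists (n %/ 3)%N; lia.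
  have [->|[->|[->|->]]] : n = 1%N \/ n = 4%N \/ n = 7%N \/ n = 10%N by lia.
  + exact: book6_cover_widen book6_cover2.
  + exact: book6_cover4.
  + exact: book6_cover7.
  + exact: book6_cover10.
(* With [n = 3 * s + 2], restrict the cover of [3 * (s + 1)] vertices by [s + 2] graphs. *)
have -> : ((n + 4) %/ 3 = (n %/ 3).+2)%N by lia.
by apply: book6_cover_widen (book6_cover_mul3 (_ : 0 < (n %/ 3).+1)%N); lia.
Qed.

Theorem theorem1 (R : realType) :
  girth_thickness R 6 (complete_graph 2) = 1%N /\
  (forall n : nat, (1 <= n)%N -> n <> 2%N ->
     ~ (exists t : nat, (4 <= t)%N /\ n = (3 * t + 1)%N) ->
     (girth_thickness R 6 (complete_graph n))%:Z
       = Num.ceil ((n%:R + 2) / 3 : rat)).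
Proof.
split.
  apply: girth_thickness_eq => [|j]; last exact: complete_cover_ge1.
  exact: book6_cover_complete book6_cover2.
move=> n n1 n2 n3t; have k0 : (0 < (n + 4) %/ 3)%N by lia.
rewrite (girth_thickness_eq (k := ((n + 4) %/ 3)%N)).
(* Rounding [(n + 2) / 3] up is rounding [(n + 4) / 3] down. *)
- apply/esym/ceil_def.
  have /andP[lo hi] : (3 * ((n + 4) %/ 3) < n + 5)%N && (n + 2 <= 3 * ((n + 4) %/ 3))%N by lia.
  set k := ((n + 4) %/ 3)%N in lo hi *.
  rewrite intrB -!pmulrn ltr_pdivlMr // ler_pdivrMr //.
  have {}lo : ((3 * k)%N%:R < (n + 5)%N%:R :> rat) by rewrite ltr_nat.
  have {}hi : ((n + 2)%N%:R <= (3 * k)%N%:R :> rat) by rewrite ler_nat.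
  by move: lo hi; rewrite !natrM !natrD; lra.
- exact: book6_cover_complete (complete_book6_cover n1 n2 n3t).
move=> j Hj.
have [n4|n4] := leqP 4 n.
  have H := complete_cover_bound n4 Hj.
  rewrite leqNgt; apply/negP => jk.
  (* This would give [n * (n - 1) <= (n + 1) * (n - 2)], but the right side is smaller by 2. *)
  have j3 : (j * 3 <= n + 1)%N by lia.
  have := leq_trans H (_ : _ <= (n + 1) * (n - 2))%N.
  by rewrite mulnA leq_mul2r j3 orbT => /(_ isT); clear -n4; nia.
have [->|nE] : n = 1%N \/ n = 3%N by lia.
  exact: complete_cover_ge1 Hj.
by subst n; exact: complete_graph3_cover_ge2 Hj.
Qed.
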